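(* Let $X_1,\ldots,X_n$ be independent, identically distributed random variables with $\mathbb{E} X_1=0$ and $\mathbb{E} X_1^2=1$, and write $X=(X_1,\ldots,X_n)$. Let $\theta_1,\ldots,\theta_k$ be fixed vectors in $\mathbb{R}^n$, with $\theta_i=(\theta_i^1,\ldots,\theta_i^n)$, such that $\langle\theta_i,\theta_j\rangle=\delta_{ij}$ for all $i,j$. Define a random vector $S_n=(S_n^1,\ldots,S_n^k)\in\mathbb{R}^k$ by $$S_n^i=\langle\theta_i,X\rangle=\sum_{r=1}^n\theta_i^rX_r.$$ Then for every $g\in C_c^2(\mathbb{R}^k)$, $$\big|\mathbb{E} g(S_n)-\mathbb{E} g(Z)\big|\le\frac{\sqrt{k}}{2}\,\||\nabla g|\|_\infty\sqrt{\mathbb{E} X_1^4-1}\left(\sum_{i=1}^k\|\theta_i\|_4^2\right)+\frac{4}{3}k^2|g|_2\left(\mathbb{E}|X_1|^3\right)\left(\sum_{i=1}^k\|\theta_i\|_3^3\right),$$ where $Z$ is distributed as a standard normal random vector in $\mathbb{R}^k$.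
   Context: $C^2_c(\mathbb{R}^k)$ is the space of compactly supported, real-valued functions on $\mathbb{R}^k$ with two continuous derivatives. $\||\nabla g|\|_\infty=\sup_x|\nabla g(x)|$ is the maximum (Euclidean) length of the gradient of $g$. $|g|_2=\max_{i,j}\sup_x\left|\frac{\partial^2 g}{\partial x_i\partial x_j}(x)\right|$. For $\theta\in\mathbb{R}^n$, $\|\theta\|_p=\left(\sum_{r=1}^n|\theta^r|^p\right)^{1/p}$, where superscripts $r$ on vectors denote coordinates. $\langle\cdot,\cdot\rangle$ is the standard inner product on $\mathbb{R}^n$ and $\delta_{ij}$ is the Kronecker delta. *)

(* Defs.v *)
From HB Require Import structures.
From mathcomp Require Import all_boot all_order all_algebra.
From mathcomp Require Import all_classical all_reals all_analysis.

Set Implicit Arguments.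
Unset Strict Implicit.
Unset Printing Implicit Defensive.

Import Order.TTheory GRing.Theory Num.Theory.
Import numFieldNormedType.Exports.

Local Open Scope classical_set_scope.
Local Open Scope ring_scope.

Definition mutual_independence (d : measure_display) (T : measurableType d)
    (R : realType) (P : probability T R) (I : finType)
    (X : I -> {RV P >-> R}) : Prop :=
  forall (J : {set I}) (A : I -> set R),
    (forall i, measurable (A i)) ->
    (P (\bigcap_(i in [set` J]) (X i @^-1` A i)) =
     \prod_(i in J) P (X i @^-1` A i))%E.

Definition identically_distributed (d : measure_display)
    (T : measurableType d) (R : realType) (P : probability T R) (I : Type)
    (X : I -> {RV P >-> R}) : Prop :=
  forall i j (A : set R), measurable A ->
    distribution P (X i) A = distribution P (X j) A.

Definition standard_normal_vector (d : measure_display)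
    (T : measurableType d) (R : realType) (P : probability T R) (k : nat)
    (Z : 'I_k -> {RV P >-> R}) : Prop :=
  mutual_independence Z /\
  forall i (A : set R), measurable A ->
    distribution P (Z i) A = normal_prob 0 1 A.

Definition dotr (R : realType) (n : nat) (u v : 'rV[R]_n) : R :=
  \sum_(r < n) u 0 r * v 0 r.

Definition pnorm (R : realType) (n : nat) (p : R) (u : 'rV[R]_n) : R :=
  (\sum_(r < n) `|u 0 r| `^ p) `^ p^-1.

Definition partial (R : realType) (k : nat) (i : 'I_k) (g : 'rV[R]_k -> R) :
    'rV[R]_k -> R :=
  fun x => 'D_(delta_mx 0 i) g x.

Definition partially_C1 (R : realType) (k : nat) (g : 'rV[R]_k -> R) : Prop :=
  continuous g /\
  forall i : 'I_k, (forall x, derivable g x (delta_mx 0 i)) /\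
    continuous (partial i g).

Definition C2 (R : realType) (k : nat) (g : 'rV[R]_k -> R) : Prop :=
  partially_C1 g /\ forall i : 'I_k, partially_C1 (partial i g).

Definition C2c (R : realType) (k : nat) (g : 'rV[R]_k -> R) : Prop :=
  C2 g /\ compact (closure [set x | g x != 0]).

Definition grad (R : realType) (k : nat) (g : 'rV[R]_k -> R)
    (x : 'rV[R]_k) : 'rV[R]_k :=
  \row_(i < k) partial i g x.

(* The library norm `| v | on 'rV[R]_k is the sup norm, hence the explicit
   Euclidean length here. *)
Definition sup_grad (R : realType) (k : nat) (g : 'rV[R]_k -> R) : \bar R :=
  ereal_sup (range (fun x =>
    (Num.sqrt (dotr (grad g x) (grad g x)))%:E)).

(* The suprema are nonnegative, so 0 is a neutral starting value for the
   maximum. *)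
Definition sup_hess (R : realType) (k : nat) (g : 'rV[R]_k -> R) : \bar R :=
  \big[maxe/0%E]_(i < k) \big[maxe/0%E]_(j < k)
    ereal_sup (range (fun x => `|partial i (partial j g) x|%:E)).

(* Main.v *)
Require Import Defs.
From HB Require Import structures.
From mathcomp Require Import all_boot all_order all_algebra.
From mathcomp Require Import all_classical all_reals all_analysis.
From mathcomp Require Import measurable_realfun.
From mathcomp Require Import ring lra.

Set Implicit Arguments.
Unset Strict Implicit.
Unset Printing Implicit Defensive.

Import Order.TTheory GRing.Theory Num.Theory.
Import numFieldNormedType.Exports.

Local Open Scope classical_set_scope.
Local Open Scope ring_scope.

(** The two laws are joined by the rotating path
      U(x) = sin x * S + cos x * Z,    0 <= x <= pi / 2,
    where S = S_n and Z is a standard normal vector independent of S, carried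
    by a product space.  The path ends at S and starts at Z, so
    E g(S) - E g(Z) is the total increment of F(x) = E g(U(x)), and it is
    enough to show |F'(x)| <= C (sin x)^2 and to compare F with
    C (x - sin x cos x) / 2, whose increment is C * pi / 4.

    Write a = sin x, b = cos x, and v_r = (theta_1^r, ..., theta_k^r), so that
    S = sum_r X_r v_r.  Then
      F'(x) = b sum_r sum_j theta_j^r E[X_r d_j g(U)] - a sum_j E[Z_j d_j g(U)].
    Gaussian integration by parts turns the last expectations into
    b E[d_j d_j g(U)].  Orthonormality of the theta_i says that
    sum_r v_r v_r^T is the identity, so this Laplacian is a sum over r of the
    quadratic form of the Hessian at v_r (path_derivative_split), and it
    remains to compare, for each j and r,
      E[X_r d_j g(U)]   with   a sum_l theta_l^r E[d_l d_j g(U)].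
    Let X_r take a fixed value y, the other variables being averaged:
    phi(y) = E[d_j g(U with X_r = y)].  By independence the two quantities are
    E[X_r phi(X_r)] and E[phi'(X_r)], and since X_r is centered with unit
    variance their difference is controlled by E|X_r|^3 times the Lipschitz
    constant of phi' (centered_unit_variance_ibp).

    The function g has only two derivatives, but phi' is Lipschitz all the
    same: a second Gaussian integration by parts exchanges one derivative of g
    in phi' for a factor Z_l / b, and what is left can be differenced in y
    (dphi_lipschitz).  The constant a^2 / b obtained in this way is harmless
    because F' carries a factor b (path_derivative_bound).

    With E|Z_l| = 2 / sqrt(2 pi) and |v_r|_1^3 <= k^2 sum_i |theta_i^r|^3
    (cube_sum_le) the resulting constant is 3/8 sqrt(2 pi) <= 4/3
    (smart_path_constant).  The Hessian term of the theorem thus dominates by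
    itself (third_moment_bound), and the gradient term is nonnegative. *)

(** * Differential calculus in coordinates *)

Section calculus.
Context {R : realType}.

Lemma continuous_of_derive (f df : R -> R) :
  (forall x : R, is_derive x 1 f (df x)) -> continuous f.
Proof.
move=> dF y; apply/differentiable_continuous/derivable1_diffP.
by have [] := dF y.
Qed.

Lemma continuous_sumr (T : topologicalType) (I : finType) (f : I -> T -> R) :
  (forall i, continuous (f i)) -> continuous (fun x => \sum_i f i x).
Proof.
move=> cf; apply: (@continuous_big _ _ (+%R : R -> R -> R) 0 xpredT) => //.
exact: add_continuous.
Qed.

Lemma is_derive_coord (k : nat) (g : 'rV[R]_k -> R) (i : 'I_k) (x : 'rV[R]_k)
    (c : R) :
  (forall y, derivable g y (delta_mx 0 i)) ->
  is_derive c 1 (fun c : R => g (x + c *: delta_mx 0 i))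
    (partial i g (x + c *: delta_mx 0 i)).
Proof.
move=> dg; pose f (s : R) : R := g (x + s *: delta_mx 0 i).
have E : (fun h : R => h^-1 *: (f (h *: 1 + c) - f c)) =
  (fun h : R => h^-1 *: (g (h *: delta_mx 0 i + (x + c *: delta_mx 0 i))
   - g (x + c *: delta_mx 0 i))).
  apply/funext => h; rewrite /f -[h *: 1]/(h * 1) mulr1.
  by rewrite [in LHS]scalerDl [in LHS]addrCA.
apply: DeriveDef; first by rewrite /derivable -/f E; exact: dg.
by rewrite /derive -/f E.
Qed.

Lemma increment_coord (k : nat) (g : 'rV[R]_k -> R) (i : 'I_k) (x : 'rV[R]_k)
    (c : R) :
  (forall y, derivable g y (delta_mx 0 i)) ->
  exists2 s, `|s| <= `|c| & g (x + c *: delta_mx 0 i) - g x =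
    c * partial i g (x + s *: delta_mx 0 i).
Proof.
move=> dg; pose f (c : R) := g (x + c *: delta_mx 0 i).
have df (c' : R) : is_derive c' 1 f (partial i g (x + c' *: delta_mx 0 i)).
  exact: is_derive_coord.
have cf : continuous f := continuous_of_derive df.
have f0 : f 0 = g x by rewrite /f scale0r addr0.
rewrite -f0 -/(f c).
have [c0|c0] := leP 0 c.
  have [s + ->] := MVT_segment c0 (fun y _ => df y) (continuous_subspaceT cf).
  rewrite in_itv/= => /andP[s0 sc]; exists s; first by rewrite !ger0_norm.
  by rewrite subr0 mulrC.
have [s + E] := MVT_segment (ltW c0) (fun y _ => df y) (continuous_subspaceT cf).
rewrite in_itv/= => /andP[s0 sc]; exists s.
  by rewrite !ler0_norm ?lerN2// ltW.
by rewrite -opprB E sub0r mulrN opprK mulrC.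
Qed.

(** Go from x to x + v changing one coordinate at a time, apply the mean value
    theorem on each leg, and use that the partial derivatives at the
    intermediate points are close to those at x. *)
Lemma partially_C1_increment (k : nat) (g : 'rV[R]_k -> R) (x : 'rV[R]_k)
    (e : R) : partially_C1 g -> 0 < e ->
  exists2 d, 0 < d & forall v : 'rV[R]_k, `|v| < d ->
  `|g (x + v) - g x - \sum_(i < k) v 0 i * partial i g x| <= e * `|v|.
Proof.
move=> [cg dg] e0.
have H : \forall y \near x, forall i : 'I_k,
    `|partial i g x - partial i g y| <= e / k.+1%:R.
  apply: (@filter_forall _ _ (fun i y =>
    `|partial i g x - partial i g y| <= e / k.+1%:R) (nbhs x)) => i.
  have /cvgrPdist_le := (dg i).2 x; apply.
  by rewrite divr_gt0.
have [d /= d0 Hd] := (nbhs_ballP _ _).1 H.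
exists d => // v vd.
(* p m is x with its first m coordinates already moved to those of x + v *)
pose p (m : nat) : 'rV[R]_k := x + \row_i (if (i < m)%N then v 0 i else 0).
have pE (m : 'I_k) : p m.+1 = p m + v 0 m *: delta_mx 0 m.
  rewrite /p -addrA; congr (_ + _); apply/rowP => j; rewrite !mxE eqxx/=.
  rewrite ltnS leq_eqVlt; have [->|jm] := eqVneq j m.
    by rewrite eqxx ltnn mulr1 add0r.
  by rewrite -[(j == m :> nat)]/(j == m) (negbTE jm)/= mulr0 addr0.
have p0 : p 0%N = x.
  by rewrite /p (_ : \row_i _ = 0) ?addr0//; apply/rowP => j; rewrite !mxE.
have pk : p k = x + v.
  by rewrite /p; congr (_ + _); apply/rowP => j; rewrite !mxE ltn_ord.
have -> : g (x + v) - g x = \sum_(i < k) (g (p i.+1) - g (p i)).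
  rewrite -pk -{1}p0 -(big_mkord xpredT (fun i => g (p i.+1) - g (p i))).
  by rewrite telescope_sumr.
rewrite -sumrB.
have B (i : 'I_k) : `|g (p i.+1) - g (p i) - v 0 i * partial i g x| <=
    e / k.+1%:R * `|v|.
  have [s sv] := increment_coord (p i) (v 0 i) (dg i).1.
  rewrite pE => ->; rewrite -mulrBr normrM mulrC ler_pM//; last first.
    rewrite [leRHS]/Num.Def.normr/= mx_normrE.
    by apply: le_trans; last exact: (le_bigmax _ _ (0, i)).
  rewrite distrC; apply: Hd; rewrite /= mx_norm_ball /ball_/= opprD addrA.
  apply: (le_lt_trans _ vd).
  rewrite [leLHS]/Num.Def.normr/= mx_normrE.
  apply: bigmax_le => // -[a j] _ /=.
  rewrite /p !mxE (ord1 a) opprD addrA subrr add0r eqxx/=.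
  have vj : forall l, `|v 0 l| <= `|v|.
    move=> l; rewrite [leRHS]/Num.Def.normr/= mx_normrE.
    by apply: le_trans; last exact: (le_bigmax _ _ (0, l)).
  have [->|ji] := eqVneq j i.
    by rewrite ltnn oppr0 add0r normrN mulr1 (le_trans sv).
  rewrite mulr0 subr0 normrN; case: ifP => // _.
  by rewrite normr0.
apply: (le_trans (ler_norm_sum _ _ _)).
apply: (le_trans (ler_sum _ (fun i _ => B i))).
rewrite sumr_const card_ord -[leLHS]mulr_natr.
rewrite [leLHS]mulrAC; apply: ler_wpM2r => //.
by rewrite -mulrA ger_pMr// mulrC ler_pdivrMr// mul1r ler_nat.
Qed.

(** Continuous partial derivatives make g differentiable, hence the chain rule
    along any curve with derivable coordinates. *)
Lemma partially_C1_chain (k : nat) (g : 'rV[R]_k -> R) (u du : 'I_k -> R -> R)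
    (t : R) : partially_C1 g ->
  (forall i, is_derive t 1 (u i) (du i t)) ->
  is_derive t 1 (fun s => g (\row_i u i s))
    (\sum_(i < k) du i t * partial i g (\row_i u i t)).
Proof.
move=> C1g du'.
pose c s : 'rV[R]_k := \row_i u i s.
have dc : derivable c t 1.
  apply/derivable_mxP => a j; rewrite /c.
  rewrite (_ : (fun x : R => _) = u j); last by apply/funext => s; rewrite mxE.
  by have [] := du' j.
pose L (v : 'rV[R]_k) : R := \sum_(i < k) v 0 i * partial i g (c t).
have L_lin : linear L.
  move=> a v w; rewrite /L scaler_sumr -big_split/=; apply: eq_bigr => i _.
  by rewrite !mxE mulrDl -mulrA.
pose HL := GRing.isLinear.Build _ _ _ _ L L_lin.
pose Lf : {linear 'rV[R]_k -> R^o} := HB.pack L HL.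
have Lc : continuous Lf.
  apply: continuous_sumr => i v.
  by apply: (@cvgM R _ (nbhs v)); [exact: (@coord_continuous R 1 k 0 i v)|exact: cvg_cst].
pose gg : 'rV[R]_k -> R^o := g.
have E : gg \o shift (c t) = cst (gg (c t)) + Lf +o_ (0 : 'rV[R]_k) id.
  apply/eqaddoP => e e0 /=.
  have [d d0 H] := partially_C1_increment (c t) C1g e0.
  have : \forall v \near (0 : 'rV[R]_k), `|v| < d by exact: nbhs0_lt.
  apply: filterS => v vd.
  have := H _ vd.
  by rewrite /= !fctE/= (addrC v) opprD addrA.
have dg : 'd gg (c t) = Lf :> (_ -> _) by exact: diff_unique.
have ddg : differentiable gg (c t).
  by apply/diff_locallyP; rewrite dg.
have ddc : differentiable c t by exact/derivable1_diffP.
have D : differentiable (gg \o c) t by exact: differentiable_comp.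
rewrite -[X in is_derive _ _ X]/(gg \o c).
apply: DeriveDef; first exact/derivable1_diffP.
rewrite deriveE// diff_comp//= dg /= /L -deriveE// derive_mx//.
apply: eq_bigr => i _; rewrite !mxE; congr (_ * _).
rewrite (_ : (fun x : R => _) = u i); last by apply/funext => s; rewrite mxE.
by have [_] := du' i.
Qed.

End calculus.

(** * Comparison of increments on the line *)

Section comparison.
Context {R : realType}.

Lemma norm_increment_le (F f G g : R -> R) (a b : R) :
  (forall x : R, is_derive x 1 F (f x)) -> (forall x : R, is_derive x 1 G (g x)) ->
  a <= b -> (forall x, a < x < b -> `|f x| <= g x) ->
  `|F b - F a| <= G b - G a.
Proof.
move=> dF dG ab fg.
have H (e : R) : `|e| = 1 -> e * (F b - F a) <= G b - G a.
  move=> e1.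
  have dH (x : R) : is_derive x 1 (fun y => G y - e * F y) (g x - e * f x).
    by apply: is_deriveB; apply: is_deriveZ.
  have cH := continuous_of_derive dH.
  have [->|ab'] := eqVneq a b; first by rewrite !subrr mulr0.
  have {}ab : a < b by rewrite lt_neqAle ab'.
  have [c] := MVT ab (fun x _ => dH x) (continuous_subspaceT cH).
  rewrite in_itv/= => cab E.
  rewrite -subr_ge0 mulrBr.
  have -> : G b - G a - (e * F b - e * F a) = (g c - e * f c) * (b - a).
    by rewrite -E; ring.
  rewrite mulr_ge0 ?subr_ge0 ?(ltW ab)//.
  by rewrite (le_trans _ (fg c cab))// (le_trans (ler_norm _))// normrM e1 mul1r.
rewrite ler_norml; apply/andP; split.
  by have := H (-1); rewrite normrN1 mulN1r => /(_ erefl); rewrite lerNl.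
by have := H 1; rewrite normr1 mul1r => /(_ erefl).
Qed.

Lemma lipschitz_of_derive (f df : R -> R) (K x y : R) :
  (forall x : R, is_derive x 1 f (df x)) -> (forall x, `|df x| <= K) ->
  `|f x - f y| <= K * `|x - y|.
Proof.
move=> dF dfK.
wlog yx : x y / y <= x.
  move=> W; have [yx|xy] := leP y x; first exact: W.
  by rewrite distrC [`|x - y|]distrC; apply: W; exact: ltW.
rewrite [`|x - y|]ger0_norm ?subr_ge0// mulrBr.
apply: (@norm_increment_le f df (fun z => K * z) (fun=> K)) => //.
by move=> z; apply: is_derive_eq; rewrite -![_ *: _]/(_ * _) mulr1.
Qed.

Lemma lipschitz_continuous_real (f : R -> R) (K : R) :
  (forall x y, `|f x - f y| <= K * `|x - y|) -> continuous f.
Proof.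
move=> L x; apply/cvgrPdist_le => e e0.
have K1 : 0 < `|K| + 1 by rewrite ltr_wpDl.
near=> y.
rewrite (le_trans (L x y))// (@le_trans _ _ ((`|K| + 1) * `|x - y|))//.
  by rewrite ler_wpM2r// (le_trans (ler_norm K))// lerDl.
rewrite -ler_pdivlMl// mulrC.
near: y; apply: cvgr_dist_le; first exact: cvg_id.
by rewrite divr_gt0.
Unshelve. all: by end_near. Qed.

(** The remainder f x - f 0 - x f' 0 has derivative at most M |x|, which is the
    derivative of M x^2 / 2 on the positive side; the negative side follows by
    reflection. *)
Lemma taylor1_lipschitz (f df : R -> R) (M x : R) :
  (forall x : R, is_derive x 1 f (df x)) ->
  (forall x, `|df x - df 0| <= M * `|x|) ->
  `|f x - f 0 - x * df 0| <= M * x ^+ 2 / 2.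
Proof.
move=> df' L.
have H (h dh : R -> R) (y : R) : 0 <= y ->
    (forall x : R, is_derive x 1 h (dh x)) ->
    (forall x, `|dh x - dh 0| <= M * `|x|) ->
    `|h y - h 0 - y * dh 0| <= M * y ^+ 2 / 2.
  move=> y0 dh' Lh.
  have := @norm_increment_le (fun z => h z - z * dh 0) (fun z => dh z - dh 0)
    (fun z => M * z ^+ 2 / 2) (fun z => M * z) 0 y _ _ y0.
  rewrite mul0r subr0 expr0n/= mulr0 mul0r subr0.
  have -> : h y - y * dh 0 - h 0 = h y - h 0 - y * dh 0 by ring.
  apply.
  - move=> z; apply: is_deriveB.
    apply: is_derive_eq.
    by rewrite scaler0 add0r -[_ *: _]/(_ * _) mulr1.
  - move=> z; apply: is_derive_eq.
    by rewrite -![_ *: _]/(_ * _); field.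
  - by move=> z /andP[z0 _]; rewrite (le_trans (Lh z))// ger0_norm// ltW.
have [x0|x0] := leP 0 x; first exact: H.
have := H (fun z => f (- z)) (fun z => - df (- z)) (- x).
rewrite oppr0 sqrrN mulrNN !opprK; apply.
- by rewrite oppr_ge0 ltW.
- move=> z.
  have dN : is_derive z 1 (fun z : R => - z) (-1) by apply: is_derive_eq.
  have := is_derive1_comp (df' (- z)) dN.
  by rewrite mulrN1.
- by move=> z; rewrite addrC distrC -[`|z|]normrN; exact: L.
Qed.

End comparison.

(** * Compactly supported functions of class C2 *)

Section compact_support.
Context {R : realType}.

Lemma bounded_compact_support (k : nat) (f : 'rV[R]_k -> R) (K : set 'rV[R]_k) :
  compact K -> continuous f -> (forall x, ~ K x -> f x = 0) ->
  exists M : R, forall x, `|f x| <= M.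
Proof.
move=> cK cf f0.
have cfK : compact (f @` K).
  by apply: continuous_compact => //; exact: continuous_subspaceT.
have [M [_ HM]] := compact_bounded cfK.
exists (Num.max 0 (M + 1)) => x.
have [Kx|nKx] := pselect (K x).
  by rewrite le_max; apply/orP; right; apply: HM => //; rewrite ltrDl.
by rewrite f0// normr0 le_max lexx.
Qed.

Lemma partial_eq0 (k : nat) (f : 'rV[R]_k -> R) (K : set 'rV[R]_k) (i : 'I_k) :
  closed K -> (forall x, ~ K x -> f x = 0) ->
  forall x, ~ K x -> partial i f x = 0.
Proof.
move=> cK f0 x nKx; rewrite /partial.
have oK : \forall y \near x, ~ K y.
  by have := closed_openC cK; rewrite openE => /(_ _ nKx).
have E : \forall y \near x, f y = cst 0 y.
  by apply: filterS oK => y /f0.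
have d0 : delta_mx 0 i != 0 :> 'rV[R]_k.
  by apply/eqP => /rowP/(_ i); rewrite !mxE !eqxx => /eqP; rewrite oner_eq0.
by rewrite (near_eq_derive _ E) ?derive_cst.
Qed.

(** All derivatives up to order two vanish off the support, because it is
    closed, and are bounded on it, because it is compact. *)
Lemma C2c_bounded (k : nat) (g : 'rV[R]_k -> R) : C2c g ->
  exists B : R, [/\ forall x, `|g x| <= B, forall i x, `|partial i g x| <= B &
    forall i j x, `|partial i (partial j g) x| <= B].
Proof.
move=> [[[cg dg] ddg] cK].
set K := closure _ in cK.
have clK : closed K by exact: closed_closure.
have g0 x : ~ K x -> g x = 0.
  move=> nKx; apply/eqP/negPn/negP => gx; apply: nKx.
  exact: subset_closure.
have dg0 i x : ~ K x -> partial i g x = 0 by exact: partial_eq0.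
have ddg0 i j x : ~ K x -> partial i (partial j g) x = 0.
  exact: (partial_eq0 _ _ (dg0 j)).
have [B0 HB0] := bounded_compact_support cK cg g0.
have /choice[B1 HB1] i := bounded_compact_support cK (dg i).2 (dg0 i).
have /choice[B2 HB2] (ij : 'I_k * 'I_k) :=
  bounded_compact_support cK ((ddg ij.2).2 ij.1).2 (ddg0 ij.1 ij.2).
pose B1' := \sum_i `|B1 i|; pose B2' := \sum_ij `|B2 ij|.
have B1p : 0 <= B1' by apply: sumr_ge0.
have B2p : 0 <= B2' by apply: sumr_ge0.
have B0p : 0 <= B0 by apply: le_trans (HB0 0).
exists (B0 + B1' + B2'); split => [x|i x|i j x].
- by rewrite (le_trans (HB0 x))// -addrA lerDl addr_ge0.
- rewrite (le_trans (HB1 i x))// (le_trans (ler_norm _))//.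
  have : `|B1 i| <= B1' by rewrite /B1' (bigD1 i)//= lerDl sumr_ge0.
  by lra.
- rewrite (le_trans (HB2 (i, j) x))// (le_trans (ler_norm _))//.
  have : `|B2 (i, j)| <= B2' by rewrite /B2' (bigD1 (i, j))//= lerDl sumr_ge0.
  by lra.
Qed.

Lemma sup_hess_ge (k : nat) (g : 'rV[R]_k -> R) (i j : 'I_k) (x : 'rV[R]_k) :
  (`|partial i (partial j g) x|%:E <= sup_hess g)%E.
Proof.
rewrite /sup_hess; apply: le_trans; last exact: (le_bigmax _ _ i).
apply: le_trans; last exact: (le_bigmax _ _ j).
by apply: ereal_sup_ubound; exists x.
Qed.

Lemma sup_hess_ge0 (k : nat) (g : 'rV[R]_k -> R) : (0 <= sup_hess g)%E.
Proof. exact: bigmax_ge_id. Qed.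

Lemma sup_grad_ge0 (k : nat) (g : 'rV[R]_k -> R) : (0 <= sup_grad g)%E.
Proof.
apply: (@le_trans _ _ (Num.sqrt (dotr (grad g 0) (grad g 0)))%:E).
  by rewrite lee_fin sqrtr_ge0.
by apply: ereal_sup_ubound; exists 0.
Qed.

Lemma sup_hess_fin (k : nat) (g : 'rV[R]_k -> R) : C2c g ->
  exists2 H : R, sup_hess g = H%:E &
    forall i j x, `|partial i (partial j g) x| <= H.
Proof.
move=> /C2c_bounded[B [B0 _ HB]].
have f : sup_hess g \is a fin_num.
  rewrite ge0_fin_numE ?sup_hess_ge0//; apply: (@le_lt_trans _ _ B%:E); last first.
    exact: ltry.
  have B0' : (0 <= B%:E)%E by rewrite lee_fin (le_trans _ (B0 0)).
  apply: bigmax_le => // i _; apply: bigmax_le => // j _.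
  by apply: ge_ereal_sup => _ [x _ <-]; rewrite lee_fin.
exists (fine (sup_hess g)); first by rewrite fineK.
by move=> i j x; rewrite -lee_fin fineK// sup_hess_ge.
Qed.

End compact_support.

(** * Measurability and independence of finite families *)

Section measurable_rows.
Context {R : realType}.

Lemma row_box_nbhs (k : nat) (V : set 'rV[R]_k) (x : 'rV[R]_k) : open V -> V x ->
  exists ab : {ffun 'I_k -> rat * rat},
    (forall i, ratr (ab i).1 < x 0 i < ratr (ab i).2) /\
    forall y : 'rV[R]_k,
      (forall i, ratr (ab i).1 < y 0 i < ratr (ab i).2) -> V y.
Proof.
rewrite openE => /[apply] /nbhs_ballP[e /= e0 eV].
have lo i : x 0 i - e < x 0 i by rewrite ltrBlDr ltrDl.
have hi i : x 0 i < x 0 i + e by rewrite ltrDl.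
have /choice[a Ha] i := rat_in_itvoo (lo i).
have /choice[b Hb] i := rat_in_itvoo (hi i).
exists [ffun i => (a i, b i)]; split => [i|y Hy].
  move: (Ha i) (Hb i); rewrite ffunE !in_itv/=.
  by move=> /andP[_ ->] /andP[-> _].
apply: eV => /=; rewrite mx_norm_ball /ball_/=.
rewrite [ltLHS]/Num.Def.normr/= mx_normrE.
apply: bigmax_lt => //= -[j i] _ /=; rewrite !mxE (ord1 j).
move: (Hy i) (Ha i) (Hb i); rewrite ffunE !in_itv/= ltr_norml.
by move=> /andP[? ?] /andP[? ?] /andP[? ?]; apply/andP; split; lra.
Qed.

(** An open set of rows is a countable union of boxes with rational corners, and
    the preimage of a box is a finite intersection of preimages of intervals. *)
Lemma measurable_continuous_row d (T : measurableType d) (k : nat)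
    (f : 'rV[R]_k -> R) (u : 'I_k -> T -> R) : continuous f ->
  (forall i, measurable_fun [set: T] (u i)) ->
  measurable_fun [set: T] (fun w => f (\row_i u i w)).
Proof.
move=> cf mu _.
apply: (measurability _ (RGenOInfty.measurableE R)) => //.
move=> _ [_ [r ->] <-]; rewrite setTI.
pose V := f @^-1` `]r, +oo[.
have oV : open V by apply: open_comp => // ? _; exact: cf.
pose box (ab : {ffun 'I_k -> rat * rat}) : set 'rV[R]_k :=
  [set y | forall i, ratr (ab i).1 < y 0 i < ratr (ab i).2].
have -> : (fun w => f (\row_i u i w)) @^-1` `]r, +oo[ =
    \bigcup_(ab in [set: {ffun 'I_k -> rat * rat}]) (fun w =>
      (if `[< box ab `<=` V >] then (fun w => \row_i u i w) @^-1` box ab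
       else set0) w).
  apply/seteqP; split => [w Vw|w [ab _]].
    have [ab [xab abV]] := row_box_nbhs oV Vw.
    by exists ab => //; case: asboolP => // /(_ abV).
  by case: asboolP => // sub /sub.
apply: countable_bigcupT_measurable; first exact: countableP.
move=> ab; case: asboolP => _; last exact: measurable0.
have -> : (fun w => \row_i u i w) @^-1` box ab =
    \bigcap_(i in [set: 'I_k]) (u i @^-1` `]ratr (ab i).1, ratr (ab i).2[).
  apply/seteqP; split => [w /= H i _|w /= H i].
    by move: (H i); rewrite /= mxE in_itv.
  by move: (H i I); rewrite /= mxE in_itv.
apply: fin_bigcap_measurable => //.
by move=> i _; rewrite -[X in measurable X]setTI; exact: mu.
Qed.

End measurable_rows.

Section independence.
Context {R : realType} (I : finType).

Definition rectangle (A : I -> set R) : set (I -> R) :=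
  [set t | forall i, A i (t i)].

Definition rectangles : set (set (I -> R)) :=
  [set rectangle A | A in [set A | forall i, measurable (A i)]].

(** The functions I -> R with the product sigma-algebra. *)
Definition vectors := g_sigma_algebraType rectangles.

HB.instance Definition _ := Measurable.on vectors.

Lemma measurable_vectors_coord (i : I) :
  measurable_fun [set: vectors] (fun t : vectors => t i : R).
Proof.
move=> _ A mA; rewrite setTI; apply: sub_sigma_algebra.
exists (fun j => if j == i then A else setT); first by move=> j /=; case: ifP.
apply/seteqP; split => [t /(_ i)|t At j] /=; first by rewrite eqxx.
by case: eqP => // ->.
Qed.

Lemma measurable_to_vectors d (T : measurableType d) (Y : T -> vectors) :
  (forall i, measurable_fun [set: T] (fun w => Y w i)) ->
  measurable_fun [set: T] Y.
Proof.
move=> mY; apply: (@measurability _ _ T vectors setT Y rectangles) => //.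
move=> _ [_ [A mA <-] <-]; rewrite setTI.
have -> : Y @^-1` rectangle A = \bigcap_(i in [set: I]) ((fun w => Y w i) @^-1` A i).
  by apply/seteqP; split => [w H i _|w H i]; exact: H.
apply: fin_bigcap_measurable => //.
by move=> i _; rewrite -[X in measurable X]setTI; apply: mY => //; exact: mA.
Qed.

Definition upd (t : I -> R) (i : I) (x : R) : I -> R :=
  fun j => if j == i then x else t j.

Lemma rectangle_setI : setI_closed rectangles.
Proof.
move=> _ _ [A mA <-] [B mB <-]; exists (fun i => A i `&` B i).
  by move=> i; apply: measurableI; [exact: mA|exact: mB].
apply/seteqP; split => [t H|t [HA HB] i]; last by split; [exact: HA|exact: HB].
by split => i; have [] := H i.
Qed.

(** The product rule for the full family only: the rule for a subfamily is
    recovered by taking the whole line for the remaining sets. *)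
Definition independent d (T : measurableType d) (P : probability T R)
    (Y : I -> T -> R) :=
  forall A : I -> set R, (forall i, measurable (A i)) ->
  (P [set w | forall i, A i (Y i w)] = \prod_i P (Y i @^-1` A i))%E.

End independence.
Arguments vectors : clear implicits.

Section resampling.
Context {R : realType} (I : finType) d (T : measurableType d).
Variables (P : probability T R) (Y : I -> T -> R).
Hypothesis mY : forall i, measurable_fun [set: T] (Y i).
Hypothesis iY : independent P Y.
Variable i : I.

Let V (w : T) : vectors R I := Y^~ w.
Let W (z : T * T) : vectors R I := upd (Y^~ z.1) i (Y i z.2).

Let mV : measurable_fun [set: T] V.
Proof. exact: measurable_to_vectors. Qed.

Let mW : measurable_fun [set: T * T] W.
Proof.
apply: measurable_to_vectors => j; rewrite /W /upd; case: eqP => _.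
  by apply: measurableT_comp => //; exact: mY.
by apply: measurableT_comp => //; exact: mY.
Qed.

(** Replacing the i-th variable by an independent copy of itself does not change
    the law of an independent family: both laws give the same mass to
    rectangles, which form a pi-system generating the sigma-algebra. *)
Lemma resample_measure (B : set (vectors R I)) : measurable B ->
  pushforward P V B = pushforward (P \x P)%E W B.
Proof.
have mYA j (A : set R) : measurable A -> measurable (Y j @^-1` A).
  by move=> mA; rewrite -[X in measurable X]setTI; exact: mY.
pose g (n : nat) := rectangle (fun _ : I => [set: R]).
apply: (@measure_unique _ _ (vectors R I) (@rectangles R I) g) => //.
- exact: rectangle_setI.
- by move=> n; exists (fun=> setT).
- by apply/seteqP; split => // t _; exists 0%N.
- move=> _ [A mA <-]; rewrite /pushforward.
  have WE : W @^-1` rectangle A =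
      [set w | forall j, (if j == i then setT else A j) (Y j w)] `*` (Y i @^-1` A i).
    apply/seteqP; split => [z H|z [H1 H2] j] /=.
      split; last by have := H i; rewrite /W /upd eqxx.
      by move=> j; have := H j; rewrite /W /upd /=; case: ifP.
    rewrite /W /upd; by have := H1 j; case: eqP => // -> _; exact: H2.
  rewrite -[RHS]/((P \x P)%E (W @^-1` rectangle A)) WE.
  have mA' j : measurable (if j == i then setT else A j).
    by case: ifP => // _; exact: mA.
  rewrite product_measure1E; last by apply: mYA; exact: mA.
    rewrite -[LHS]/(P [set w | forall j, A j (Y j w)]) (iY mA) [X in _ = (X * _)%E](iY mA').
    rewrite (bigD1 i)//= [in RHS](bigD1 i)//= eqxx preimage_setT probability_setT.
    rewrite mul1e muleC; congr (_ * _)%E.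
    by apply: eq_bigr => j /negbTE ->.
  have -> : [set w | forall j, (if j == i then setT else A j) (Y j w)] =
      \bigcap_(j in [set: I]) (Y j @^-1` (if j == i then setT else A j)).
    by apply/seteqP; split => [w H j _|w H j]; exact: H.
  apply: fin_bigcap_measurable => //.
  by move=> j _; apply: mYA.
- move=> n; rewrite (le_lt_trans (probability_le1 P _)) ?ltry//.
  rewrite -[X in measurable X]setTI; apply: mV => //.
  by apply: sub_sigma_algebra; exists (fun=> setT).
Qed.

End resampling.

(** * Integrals over a probability space *)

Section probability_integrals.
Context {R : realType} d (T : measurableType d) (P : probability T R).
Implicit Types f g : T -> R.

Lemma integrable_norm_le f g : measurable_fun [set: T] f ->
  P.-integrable [set: T] (EFin \o g) -> (forall x, `|f x| <= g x) ->
  P.-integrable [set: T] (EFin \o f).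
Proof.
move=> mf ig fg; apply: (le_integrable measurableT _ _ ig).
  exact/measurable_EFinP.
by move=> x _ /=; rewrite lee_fin (le_trans (fg x))// ler_norm.
Qed.

Lemma integrable_bounded f (M : R) : measurable_fun [set: T] f ->
  (forall x, `|f x| <= M) -> P.-integrable [set: T] (EFin \o f).
Proof.
move=> mf fM; apply: (integrable_norm_le mf _ fM).
exact: finite_measure_integrable_cst.
Qed.

Lemma integrable_mul_bounded f g (M : R) :
  P.-integrable [set: T] (EFin \o f) -> measurable_fun [set: T] g ->
  (forall x, `|g x| <= M) ->
  P.-integrable [set: T] (EFin \o (fun x => f x * g x)).
Proof.
move=> jf mg gM.
have mf : measurable_fun [set: T] f by exact/measurable_EFinP/(measurable_int P).
apply: (@integrable_norm_le _ (fun x => `|f x| * M)).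
- exact: measurable_funM.
- have := integrableZr measurableT M (integrable_norm jf).
  by [].
- by move=> x; rewrite normrM ler_wpM2l.
Qed.

Lemma norm_Rintegral_le f (M : R) : measurable_fun [set: T] f ->
  (forall x, `|f x| <= M) -> `|\int[P]_x f x| <= M.
Proof.
move=> mf fM; have jf := integrable_bounded mf fM.
apply: (le_trans (le_normr_Rintegral measurableT jf)).
have -> : M = \int[P]_x (cst M x).
  by rewrite Rintegral_cst// [X in fine X](probability_setT P) mulr1.
apply: le_Rintegral => //; first exact: integrable_norm.
exact: finite_measure_integrable_cst.
Qed.

Lemma Rintegral_sumr (J : finType) (F : J -> T -> R) :
  (forall j, P.-integrable [set: T] (EFin \o F j)) ->
  \int[P]_x (\sum_j F j x) = \sum_j \int[P]_x F j x.
Proof.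
move=> jF; rewrite /Rintegral.
under eq_integral do rewrite -sumEFin.
rewrite integral_sum//.
by rewrite sum_fine// => j _; exact: (integrable_fin_num _ (jF j)).
Qed.

Lemma integrable_sumr (J : finType) (F : J -> T -> R) :
  (forall j, P.-integrable [set: T] (EFin \o F j)) ->
  P.-integrable [set: T] (EFin \o (fun x => \sum_j F j x)).
Proof.
move=> jF; apply: (eq_integrable _ (fun x => \sum_j (F j x)%:E)%E) => //.
  by move=> x _; rewrite /= sumEFin.
by apply: integrable_sum => // j _; exact: jF.
Qed.

Lemma EFin_Rintegral f : P.-integrable [set: T] (EFin \o f) ->
  ((\int[P]_x f x)%:E = \int[P]_x (f x)%:E)%E.
Proof. by move=> jf; rewrite /Rintegral fineK//; exact: (integrable_fin_num _ jf). Qed.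

End probability_integrals.

Section resampled_integrals.
Context {R : realType} (I : finType) d (T : measurableType d).
Variables (P : probability T R) (Y : I -> T -> R).
Hypothesis mY : forall i, measurable_fun [set: T] (Y i).
Hypothesis iY : independent P Y.
Variables (i : I) (h : vectors R I -> R).
Hypothesis mh : measurable_fun [set: vectors R I] h.
Hypothesis jh : P.-integrable [set: T] (EFin \o (fun w => h (Y^~ w))).

Let V (w : T) : vectors R I := Y^~ w.
Let W (z : T * T) : vectors R I := upd (Y^~ z.1) i (Y i z.2).

Let mV : measurable_fun [set: T] V.
Proof. exact: measurable_to_vectors. Qed.

Let mW : measurable_fun [set: T * T] W.
Proof.
apply: measurable_to_vectors => j; rewrite /W /upd; case: eqP => _.
  by apply: measurableT_comp => //; exact: mY.
by apply: measurableT_comp => //; exact: mY.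
Qed.

Let push_eq (f : vectors R I -> \bar R) : measurable_fun [set: vectors R I] f ->
  (forall x, 0 <= f x)%E ->
  (\int[P]_w f (V w) = \int[P \x P]_z f (W z))%E.
Proof.
move=> mf f0.
have := ge0_integral_pushforward mV P measurableT mf (fun x _ => f0 x).
rewrite preimage_setT => <-.
have := ge0_integral_pushforward mW (P \x P)%E measurableT mf (fun x _ => f0 x).
rewrite preimage_setT => <-.
by apply: eq_measure_integral => B mB _; exact: resample_measure.
Qed.

Lemma resample_integrable :
  (P \x P)%E.-integrable [set: T * T] (EFin \o (h \o W)).
Proof.
apply/integrableP; split; first by apply/measurable_EFinP; exact: measurableT_comp.
have /integrableP[_] := jh.
by rewrite (@push_eq (fun t => `|(h t)%:E|)%E)//; exact/measurableT_comp/measurable_EFinP.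
Qed.

Lemma resample_integral :
  (\int[P]_w (h (Y^~ w))%:E = \int[P \x P]_z (h (W z))%:E)%E.
Proof.
have mh' : measurable_fun [set: vectors R I] (EFin \o h) by exact/measurable_EFinP.
have := @integral_pushforward _ _ _ _ _ _ mV P setT _ mh' jh measurableT.
rewrite preimage_setT => <-.
have := @integral_pushforward _ _ _ _ _ _ mW (P \x P)%E setT _ mh'
  resample_integrable measurableT.
rewrite preimage_setT => <-.
by apply: eq_measure_integral => B mB _; exact: resample_measure.
Qed.

(** The two orders of integration serve different purposes: here the copy of the
    i-th variable is integrated first, the rest of the family being frozen. *)
Lemma resample_inner :
  (forall w, P.-integrable [set: T] (EFin \o (fun w' => h (W (w, w'))))) ->
  \int[P]_w h (Y^~ w) = \int[P]_w \int[P]_w' h (upd (Y^~ w) i (Y i w')).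
Proof.
move=> jh'; rewrite /Rintegral; congr fine.
rewrite resample_integral -(integral12_prod_meas1 resample_integrable).
by apply: eq_integral => w _; exact/esym/(EFin_Rintegral (jh' w)).
Qed.

(** Here the i-th variable is frozen and the rest of the family is averaged. *)
Lemma resample_outer :
  (forall w', P.-integrable [set: T] (EFin \o (fun w => h (W (w, w'))))) ->
  \int[P]_w h (Y^~ w) = \int[P]_w' \int[P]_w h (upd (Y^~ w) i (Y i w')).
Proof.
move=> jh'; rewrite /Rintegral; congr fine.
rewrite resample_integral -(integral21_prod_meas1 resample_integrable).
by apply: eq_integral => w _; exact/esym/(EFin_Rintegral (jh' w)).
Qed.

End resampled_integrals.

(** * The standard normal law *)

Section standard_normal.
Context {R : realType}.
Local Notation mu := (@lebesgue_measure R).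
Local Notation nu := (@normal_prob R 0 1).
Let p : R -> R := normal_pdf 0 1.
Let c : R := (Num.sqrt (pi *+ 2))^-1.

Let pE x : p x = c * expR (- (x ^+ 2 / 2)).
Proof.
rewrite /p normal_pdfE ?oner_neq0// /normal_peak /normal_fun subr0 !expr1n.
by rewrite mul1r mulNr.
Qed.

Let p_ge0 x : 0 <= p x. Proof. exact: normal_pdf_ge0. Qed.

Let cp : continuous p.
Proof. by apply: continuous_normal_pdf; rewrite oner_neq0. Qed.

Let mp : measurable_fun [set: R] p. Proof. exact: measurable_normal_pdf. Qed.

Let is_derive_p (x : R) : is_derive x 1 p (- x * p x).
Proof.
have E : p = (fun x => c * expR (- (x ^+ 2 / 2))) by apply/funext => y.
rewrite pE E; apply: is_derive_eq.
rewrite -![_ *: _]/(_ * _).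
by field.
Qed.

Let p_cvg0 : p x @[x --> +oo] --> (0 : R).
Proof.
have E : p = (fun x => c * expR (- (x ^+ 2 / 2))) by apply/funext => y.
rewrite E -[X in _ --> X](mulr0 c); apply: cvgMl_tmp.
apply: (cvg_comp (fun x : R => x ^+ 2 / 2) (fun x => expR (- x))); last exact: cvgr_expR.
apply: gt0_cvgMly; first by rewrite invr_gt0.
exact: cvgr_expr2.
Qed.

Let pN x : p (- x) = p x. Proof. by rewrite !pE sqrrN. Qed.

(** The Gaussian density agrees almost everywhere with the Radon-Nikodym
    derivative of the normal law, since both have the same integral over every
    measurable set. *)
Lemma ge0_integral_normal (f : R -> \bar R) : measurable_fun [set: R] f ->
  (forall x, 0 <= f x)%E ->
  (\int[nu]_x f x = \int[mu]_x (f x * (p x)%:E))%E.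
Proof.
move=> mf f0; have dom := @normal_prob_dominates R 0 1.
rewrite -(Radon_Nikodym_SigmaFinite.change_of_variables dom)//.
have jRN := Radon_Nikodym_SigmaFinite.f_integrable dom.
apply: ae_eq_integral => //.
- by apply: emeasurable_funM => //; apply: (measurable_int mu).
- by apply: emeasurable_funM => //; exact/measurable_EFinP.
- apply: ae_eqe_mul2l; apply: integral_ae_eq => //; first exact/measurable_EFinP.
  by move=> E _ mE; rewrite -Radon_Nikodym_SigmaFinite.f_integral.
Qed.

Lemma integral_normal (f : R -> R) : measurable_fun [set: R] f ->
  (\int[nu]_x (f x)%:E = \int[mu]_x (f x * p x)%:E)%E.
Proof.
move=> mf; have mf' : measurable_fun [set: R] (EFin \o f) by exact/measurable_EFinP.
rewrite integralE [RHS]integralE !ge0_integral_normal//.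
- congr (_ - _)%E; apply: eq_integral => x _.
    by rewrite !funeposE EFinM muleC maxe_pMr ?lee_fin// mule0 muleC.
  by rewrite !funenegE EFinM muleC maxe_pMr ?lee_fin// mule0 muleN muleC.
- exact: measurable_funeneg.
- exact: measurable_funepos.
Qed.

(** On the half-line, - p is an antiderivative of x p(x). *)
Lemma normal_abs_moment : (\int[nu]_x `|x|%:E = (2 * c)%:E)%E.
Proof.
rewrite ge0_integral_normal//; last first.
  by apply/measurable_EFinP; exact: normr_measurable.
under eq_integral do rewrite -EFinM.
rewrite (@ge0_symfun_integralT _ (fun x => `|x| * p x)); last first.
- by move=> x; rewrite /= normrN pN.
- by move=> x; apply: cvgM; [exact: norm_continuous|exact: cp].
- by move=> x; rewrite mulr_ge0.
rewrite EFinM; congr (_ * _)%E.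
rewrite -set_itvcy.
rewrite (@ge0_continuous_FTC2y _ (fun x => `|x| * p x) (fun x => - p x) 0 0).
- by rewrite sub0e -EFinN opprK pE expr0n/= mul0r oppr0 expR0 mulr1.
- by move=> x _; rewrite mulr_ge0.
- apply: continuous_subspaceT => x.
  by apply: cvgM; [exact: norm_continuous|exact: cp].
- by rewrite -oppr0; apply: cvgN.
- by move=> x _; have [] := is_deriveN (is_derive_p x).
- by apply: cvg_at_right_filter; apply: cvgN; exact: cp.
- move=> x; rewrite in_itv/= andbT => x0.
  rewrite derive1E; have [_ ->] := is_deriveN (is_derive_p x).
  by rewrite mulNr opprK ger0_norm// ltW.
Qed.

Lemma normal_integrable_id : nu.-integrable [set: R] (fun x => x%:E).
Proof.
apply/integrableP; split; first exact/measurable_EFinP.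
by have := normal_abs_moment; rewrite /= => ->; rewrite ltry.
Qed.

(** If p is the density, (f' - x f) p is the derivative of f p, which tends to 0
    at both ends of the intervals [- n, n]. *)
Lemma normal_ibp (f df : R -> R) (B : R) :
  (forall x : R, is_derive x 1 f (df x)) -> continuous df ->
  (forall x, `|f x| <= B) -> (forall x, `|df x| <= B) ->
  (\int[nu]_x (df x - x * f x)%:E = 0)%E.
Proof.
move=> dF cdf fB dfB.
have cf := continuous_of_derive dF.
have mf : measurable_fun [set: R] f by exact: continuous_measurable_fun.
have mdf : measurable_fun [set: R] df by exact: continuous_measurable_fun.
pose h x := df x - x * f x.
have ch : continuous h.
  by move=> x; apply: cvgB; [exact: cdf|apply: cvgM; [exact: cvg_id|exact: cf]].
have mh : measurable_fun [set: R] h by exact: continuous_measurable_fun.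
have jh : nu.-integrable [set: R] (EFin \o h).
  have -> : EFin \o h = ((EFin \o df) \- (EFin \o (fun x => (x * f x)%R)))%E.
    by apply/funext => x.
  apply: integrableB => //; first exact: (@integrable_bounded _ _ _ nu df B mdf dfB).
  exact: (@integrable_mul_bounded _ _ _ nu id f B normal_integrable_id mf fB).
rewrite -[LHS]/(\int[nu]_x (h x)%:E)%E integral_normal//.
have mhp : measurable_fun [set: R] (fun x => h x * p x) by exact: measurable_funM.
have jhp : mu.-integrable [set: R] (EFin \o (fun x => h x * p x)).
  apply/integrableP; split; first exact/measurable_EFinP.
  have /integrableP[_] := jh; rewrite ge0_integral_normal//; last first.
    exact/measurableT_comp/measurable_EFinP.
  congr (_ < _)%E; apply: eq_integral => x _ /=.
  by rewrite -EFinM normrM (ger0_norm (p_ge0 x)).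
(* intervals of half-length n + 1, so that they are never reduced to a point *)
pose hn n := (fun x => (h x * p x)%:E) \_ `[- n.+1%:R, n.+1%:R].
have ftc n : (\int[mu]_x hn n x = ((f n.+1%:R - f (- n.+1%:R)) * p n.+1%:R)%:E)%E.
  rewrite /hn -integral_mkcond.
  have dfp (x : R) : is_derive x 1 (fun x => f x * p x) (h x * p x).
    apply: (is_derive_eq (is_deriveM (dF x) (is_derive_p x))); rewrite -![_ *: _]/(_ * _) /h.
    by ring.
  have cfp : continuous (fun x => f x * p x).
    by move=> x; apply: cvgM; [exact: cf|exact: cp].
  rewrite (@continuous_FTC2 _ _ (fun x => f x * p x)).
  - by rewrite -EFinB pN mulrBl.
  - by rewrite (@lt_trans _ _ 0)// oppr_lt0.
  - apply: continuous_subspaceT => x.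
    by apply: cvgM; [exact: ch|exact: cp].
  - split; first by move=> x _; have [] := dfp x.
      by apply: cvg_at_right_filter; exact: cfp.
    by apply: cvg_at_left_filter; exact: cfp.
  - by move=> x _; rewrite derive1E; have [_ ->] := dfp x.
have lim0 : (\int[mu]_x hn n x @[n --> \oo] --> 0)%E.
  under eq_cvg do rewrite ftc.
  apply/cvg_EFin; first exact: nearW.
  apply: norm_cvg0; apply: (@squeeze_cvgr _ _ _ _ (cst 0) (fun n => 2 * B * p n.+1%:R)).
  - apply: nearW => n /=; rewrite normr_ge0/= normrM (ger0_norm (p_ge0 _)).
    rewrite ler_wpM2r// (le_trans (ler_normB _ _))//.
    by rewrite mulr2n mulrDl mul1r lerD.
  - exact: cvg_cst.
  - rewrite -(mulr0 (2 * B)); apply: cvgMl_tmp.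
    rewrite (cvg_shiftS (fun n => p n%:R)).
    exact: (cvg_comp _ _ cvgr_idn).
have lim1 : (\int[mu]_x hn n x @[n --> \oo] --> \int[mu]_x (h x * p x)%:E)%E.
  apply: (@dominated_cvg _ _ _ mu setT measurableT hn
    (fun x => (h x * p x)%:E) (fun x => `|h x * p x|%:E)) => //.
  - move=> n; rewrite /hn.
    apply: (iffLR (measurable_restrictT _ (measurable_itv _))).
    exact: (measurable_funTS (measurable_int mu jhp)).
  - move=> x _; apply: cvg_near_cst.
    near=> n; rewrite /hn patchE ifT// inE/= in_itv/=.
    rewrite -ler_norml (@le_trans _ _ n%:R) ?ler_nat//.
    by near: n; exact: nbhs_infty_ger.
  - exact: (integrable_norm jhp).
  - move=> n x _; rewrite /hn patchE; case: ifP => _ //.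
    by rewrite abse0 lee_fin.
exact: (cvg_unique _ lim1 lim0).
Unshelve. all: by end_near. Qed.

End standard_normal.

(** * Integration by parts for one random variable *)

Section laws_on_the_line.
Context {R : realType} d (T : measurableType d) (P : probability T R).

Definition standard_normal_law (N : T -> R) :=
  forall A : set R, measurable A -> P (N @^-1` A) = normal_prob 0 1 A.

Section gaussian.
Variable N : T -> R.
Hypothesis mN : measurable_fun [set: T] N.
Hypothesis nN : standard_normal_law N.

Let law_integral (f : R -> R) : measurable_fun [set: R] f ->
  P.-integrable [set: T] (EFin \o (f \o N)) ->
  \int[P]_w f (N w) = \int[normal_prob 0 1]_x f x.
Proof.
move=> mf jf; rewrite /Rintegral; congr fine.
(* the normal law lives on measurableTypeR R, so N is pushed forward to it *)
have mf' : measurable_fun [set: measurableTypeR R] (EFin \o f).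
  exact/measurable_EFinP.
have := @integral_pushforward _ _ T (measurableTypeR R) _ N mN P setT _ mf' jf
  measurableT.
rewrite preimage_setT => <-.
by apply: (eq_measure_integral (@normal_prob R 0 1)) => A mA _; exact: nN.
Qed.

Let law_integral_ge0 (f : R -> R) : measurable_fun [set: R] f ->
  (forall x, 0 <= f x) ->
  (\int[P]_w (f (N w))%:E = \int[normal_prob 0 1]_x (f x)%:E)%E.
Proof.
move=> mf f0.
have mf' : measurable_fun [set: measurableTypeR R] (EFin \o f).
  exact/measurable_EFinP.
have f0' x : x \in [set: measurableTypeR R] -> (0 <= (EFin \o f) x)%E.
  by rewrite lee_fin.
have := @ge0_integral_pushforward _ _ T (measurableTypeR R) _ N mN P setT _
  measurableT mf' f0'.
rewrite preimage_setT => <-.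
by apply: (eq_measure_integral (@normal_prob R 0 1)) => A mA _; exact: nN.
Qed.

Lemma gaussian_abs_moment :
  (\int[P]_w `|N w|%:E = (2 / Num.sqrt (pi *+ 2))%:E)%E.
Proof.
rewrite (law_integral_ge0 (@normr_measurable R setT) (@normr_ge0 _ _)).
exact: normal_abs_moment.
Qed.

Lemma gaussian_integrable : P.-integrable [set: T] (EFin \o N).
Proof.
apply/integrableP; split; first exact/measurable_EFinP.
by have := gaussian_abs_moment; rewrite /= => ->; rewrite ltry.
Qed.

Lemma gaussian_ibp (f df : R -> R) (B : R) :
  (forall x : R, is_derive x 1 f (df x)) -> continuous df ->
  (forall x, `|f x| <= B) -> (forall x, `|df x| <= B) ->
  \int[P]_w (N w * f (N w)) = \int[P]_w df (N w).
Proof.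
move=> dF cdf fB dfB.
have cf := continuous_of_derive dF.
have mf : measurable_fun [set: R] f by exact: continuous_measurable_fun.
have mdf : measurable_fun [set: R] df by exact: continuous_measurable_fun.
have mfN : measurable_fun [set: T] (fun w => f (N w)) by exact: measurableT_comp.
have mdfN : measurable_fun [set: T] (fun w => df (N w)) by exact: measurableT_comp.
have j1 : P.-integrable [set: T] (EFin \o (fun w => N w * f (N w))).
  exact: (integrable_mul_bounded gaussian_integrable mfN (fun w => fB _)).
have j2 : P.-integrable [set: T] (EFin \o (fun w => df (N w))).
  exact: (@integrable_bounded _ _ _ P _ B mdfN (fun w => dfB (N w))).
apply/eqP; rewrite eq_sym -subr_eq0; apply/eqP.
rewrite -RintegralB//.
rewrite (@law_integral (fun x => df x - x * f x)).
- by rewrite /Rintegral (normal_ibp dF cdf fB dfB).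
- by apply: measurable_funB => //; exact: measurable_funM.
- have -> : EFin \o ((fun x => df x - x * f x) \o N) =
    ((EFin \o (fun w => df (N w))) \- (EFin \o (fun w => (N w * f (N w))%R)))%E.
    by apply/funext => w.
  exact: integrableB.
Qed.

End gaussian.

(** A variable with the first two moments of the normal law satisfies the Gaussian
    integration by parts formula up to third-order terms.  Since E X = 0 and
    E X^2 = 1, the contributions of f 0 and f' 0 cancel, and the remainders are
    at most M |X|^3 / 2 and M |X|.  The third moment may be infinite: the bound is
    then still meaningful for M = 0, whence its formulation with extended
    reals. *)
Lemma centered_unit_variance_ibp (X : T -> R) (f df : R -> R) (M B : R) :
  measurable_fun [set: T] X ->
  P.-integrable [set: T] (EFin \o X) -> \int[P]_w X w = 0 ->
  P.-integrable [set: T] (EFin \o (fun w => X w ^+ 2)) ->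
  \int[P]_w (X w ^+ 2) = 1 ->
  0 <= M -> (forall x : R, is_derive x 1 f (df x)) -> continuous df ->
  (forall x, `|df x - df 0| <= M * `|x|) ->
  (forall x, `|f x| <= B) -> (forall x, `|df x| <= B) ->
  (`|\int[P]_w (X w * f (X w)) - \int[P]_w df (X w)|%:E <=
   (3 / 2 * M)%:E * \int[P]_w (`|X w| ^+ 3)%:E)%E.
Proof.
move=> mX jX X0 jX2 X1 M0 dF cdf L fB dfB.
have cf := continuous_of_derive dF.
have mf : measurable_fun [set: R] f by exact: continuous_measurable_fun.
have mdf : measurable_fun [set: R] df by exact: continuous_measurable_fun.
have mfX : measurable_fun [set: T] (fun w => f (X w)) by exact: measurableT_comp.
have mdfX : measurable_fun [set: T] (fun w => df (X w)) by exact: measurableT_comp.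
have j1 : P.-integrable [set: T] (EFin \o (fun w => X w * f (X w))).
  exact: (integrable_mul_bounded jX mfX (fun w => fB _)).
have j2 : P.-integrable [set: T] (EFin \o (fun w => df (X w))).
  exact: (@integrable_bounded _ _ _ P _ B mdfX (fun w => dfB (X w))).
have jZ (a : R) (h : T -> R) : P.-integrable [set: T] (EFin \o h) ->
    P.-integrable [set: T] (EFin \o (fun w => a * h w)).
  by move=> jh; have := integrableZl measurableT a jh.
have jB (h1 h2 : T -> R) : P.-integrable [set: T] (EFin \o h1) ->
    P.-integrable [set: T] (EFin \o h2) ->
    P.-integrable [set: T] (EFin \o (fun w => h1 w - h2 w)).
  by move=> jh1 jh2; have := integrableB measurableT jh1 jh2.
have jc (a : R) : P.-integrable [set: T] (EFin \o (fun w : T => a)).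
  exact: finite_measure_integrable_cst.
pose Psi w := X w * f (X w) - df (X w) - (f 0 * X w + df 0 * (X w ^+ 2 - 1)).
have j3 : P.-integrable [set: T] (EFin \o (fun w => X w * f (X w) - df (X w))).
  exact: jB.
have j5 : P.-integrable [set: T] (EFin \o (fun w => X w ^+ 2 - 1)) by exact: jB.
have j4 : P.-integrable [set: T] (EFin \o (fun w => f 0 * X w + df 0 * (X w ^+ 2 - 1))).
  by have := integrableD measurableT (jZ (f 0) _ jX) (jZ (df 0) _ j5).
have jPsi : P.-integrable [set: T] (EFin \o Psi) by exact: jB.
have mPsi : measurable_fun [set: T] Psi by exact/measurable_EFinP/(measurable_int P).
have EPsi : \int[P]_w Psi w = \int[P]_w (X w * f (X w)) - \int[P]_w df (X w).
  rewrite RintegralB// RintegralB// RintegralD//; [|exact: jZ|exact: jZ].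
  rewrite RintegralZl// RintegralZl// RintegralB// X0 X1.
  by rewrite Rintegral_cst// [X in fine X](probability_setT P)/= !mulr1 subrr !mulr0 addr0 subr0.
rewrite -EPsi.
apply: (@le_trans _ _ (\int[P]_w `|Psi w|%:E)%E).
  rewrite -(EFin_Rintegral (integrable_norm jPsi)) lee_fin.
  exact: le_normr_Rintegral.
(* M X^2 is added on both sides to keep nonnegative integrands; it integrates
   to M and cancels *)
have key w : `|Psi w| + M * X w ^+ 2 <= 3 / 2 * M * `|X w| ^+ 3 + M.
  set x := X w.
  have -> : Psi w = x * (f x - f 0 - x * df 0) - (df x - df 0).
    by rewrite /Psi -/x; ring.
  have t1 := taylor1_lipschitz x dF L.
  have t2 := L x.
  have t3 : `|x * (f x - f 0 - x * df 0) - (df x - df 0)| <=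
      `|x| * (M * x ^+ 2 / 2) + M * `|x|.
    rewrite (le_trans (ler_normB _ _))// lerD// normrM.
    by rewrite ler_wpM2l.
  have x2 : x ^+ 2 = `|x| ^+ 2 by rewrite real_normK// num_real.
  rewrite x2 in t3 *.
  have y0 : 0 <= `|x| by [].
  move: t3 y0; set y := `|x|; move=> t3 y0.
  (* y <= y^3 + 1 - y^2, whose expectation bounds E|X| by E|X|^3 *)
  have k : 0 <= M * ((y - 1) ^+ 2 * (y + 1)).
    by rewrite mulr_ge0// mulr_ge0 ?sqr_ge0// addr_ge0.
  have {}k : 0 <= M * y ^+ 3 - M * y ^+ 2 - M * y + M.
    by apply: le_trans k _; rewrite le_eqVlt; apply/orP; left; apply/eqP; ring.
  have e : y * (M * y ^+ 2 / 2) = M * y ^+ 3 / 2 by field.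
  by rewrite e in t3; lra.
have mX3 : measurable_fun [set: T] (fun w => `|X w| ^+ 3).
  by apply: measurable_funX; apply: measurableT_comp.
have jMX2 := jZ M _ jX2.
have EMX2 : (\int[P]_w (M * X w ^+ 2)%:E = M%:E)%E.
  by rewrite -(EFin_Rintegral jMX2) RintegralZl// X1 mulr1.
rewrite -(@leeD2rE _ M%:E)//.
rewrite -{1}EMX2 -ge0_integralD//=; first last.
- exact: measurable_int jMX2.
- by move=> w _; rewrite lee_fin mulr_ge0// sqr_ge0.
- exact/measurable_EFinP/measurableT_comp.
have -> : ((3 / 2 * M)%:E * \int[P]_w (`|X w| ^+ 3)%:E + M%:E =
    \int[P]_w ((3 / 2 * M * `|X w| ^+ 3)%:E + M%:E))%E.
  rewrite ge0_integralD//=; first last.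
  - exact/measurable_EFinP/measurable_funM.
  - by move=> w _; rewrite lee_fin !mulr_ge0 ?exprn_ge0.
  rewrite integral_cst//= [X in (M%:E * X)%E](probability_setT P) mule1.
  under [in RHS]eq_integral do rewrite EFinM.
  rewrite ge0_integralZl//.
  - exact/measurable_EFinP.
  - by rewrite lee_fin mulr_ge0.
apply: ge0_le_integral => //=.
- by move=> w _; rewrite lee_fin addr_ge0// mulr_ge0// sqr_ge0.
- apply/measurable_EFinP/measurable_funD; first exact: measurableT_comp.
  by apply/measurable_EFinP; exact: measurable_int jMX2.
- by apply/measurable_EFinP/measurable_funD => //; exact: measurable_funM.
- by move=> w _; rewrite lee_fin.
Qed.

End laws_on_the_line.

(** * Integration by parts in one coordinate of an independent family *)

Section derive_under_expectation.
Context {R : realType} d (T : measurableType d) (P : probability T R).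

Lemma is_derive_Rintegral (f df : R -> T -> R) (G : T -> R) (a : R) :
  (forall x, P.-integrable [set: T] (EFin \o f x)) ->
  (forall (x : R) w, is_derive x 1 (f^~ w) (df x w)) ->
  P.-integrable [set: T] (EFin \o G) ->
  (forall x w, `|df x w| <= G w) ->
  is_derive a 1 (fun x => \int[P]_w f x w) (\int[P]_w df a w).
Proof.
move=> jf dF jG dG.
have Ia : `]a - 1, a + 1[%classic a.
  by rewrite /= in_itv/= ltrBlDr ltrDl ltr01.
have G0 w : 0 <= G w by rewrite (le_trans _ (dG 0 w)).
have dd (x : R) w : partial1of2 f x w = df x w.
  by rewrite partial1of2E; have [] := dF x w.
have der (x : R) w : derivable (f^~ w) x 1 by have [] := dF x w.
have Gub (x : R) y : `](a - 1), (a + 1)[%classic x -> setT y ->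
    `|partial1of2 f x y| <= G y by rewrite dd.
have H1 := @derivable_under_integral R _ T P f setT measurableT a (a - 1)
  (a + 1) Ia (fun x _ => jf x) (fun x w _ _ => der x w) G G0 jG Gub.
have H2 := @differentiation_under_integral R _ T P f setT measurableT a (a - 1)
  (a + 1) Ia (fun x _ => jf x) (fun x w _ _ => der x w) G G0 jG Gub.
apply: DeriveDef => //; rewrite -derive1E H2.
by apply: eq_Rintegral => w _; exact: dd.
Qed.

End derive_under_expectation.

Section gaussian_coordinate.
Context {R : realType} (I : finType) d (T : measurableType d).
Variables (P : probability T R) (Y : I -> T -> R).
Hypothesis mY : forall i, measurable_fun [set: T] (Y i).
Hypothesis iY : independent P Y.

(** Integrate first over the i-th coordinate, where the one-dimensional formula
    applies, and then over the others. *)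
Lemma gaussian_coordinate_ibp (i : I) (h dh : vectors R I -> R) (B : R) :
  standard_normal_law P (Y i) ->
  measurable_fun [set: vectors R I] h -> measurable_fun [set: vectors R I] dh ->
  (forall t, `|h t| <= B) -> (forall t, `|dh t| <= B) ->
  (forall t (x : R), is_derive x 1 (fun y => h (upd t i y)) (dh (upd t i x))) ->
  (forall t, continuous (fun y => dh (upd t i y))) ->
  \int[P]_w (Y i w * h (Y^~ w)) = \int[P]_w dh (Y^~ w).
Proof.
move=> nY mh mdh hB dhB dh' cdh.
have mV : measurable_fun [set: T] (fun w => (Y^~ w : vectors R I)).
  exact: measurable_to_vectors.
have mU w : measurable_fun [set: T] (fun w' => (upd (Y^~ w) i (Y i w') : vectors R I)).
  apply: measurable_to_vectors => j; rewrite /upd; case: eqP => _ //.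
have jYi := gaussian_integrable (mY i) nY.
have jh : P.-integrable [set: T] (EFin \o (fun w => Y i w * h (Y^~ w))).
  apply: (integrable_mul_bounded jYi (M := B)) => //.
  exact: (measurableT_comp mh mV).
have jdh : P.-integrable [set: T] (EFin \o (fun w => dh (Y^~ w))).
  by apply: (@integrable_bounded _ _ _ P _ B) => //; exact: (measurableT_comp mdh mV).
rewrite (@resample_inner _ _ _ _ P Y mY iY i (fun t => t i * h t)) => //; last 2 first.
- by apply: measurable_funM => //; exact: measurable_vectors_coord.
- move=> w; rewrite /upd/= eqxx.
  apply: (integrable_mul_bounded jYi (M := B)) => //.
  exact: (measurableT_comp mh (mU w)).
rewrite (@resample_inner _ _ _ _ P Y mY iY i dh) => //; last first.
  move=> w; apply: (@integrable_bounded _ _ _ P _ B) => //.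
  exact: (measurableT_comp mdh (mU w)).
apply: eq_Rintegral => w _.
rewrite -(gaussian_ibp (mY i) nY (dh' (Y^~ w)) (cdh (Y^~ w)) (B := B))//.
by apply: eq_Rintegral => w' _; rewrite /upd eqxx.
Qed.

End gaussian_coordinate.

(** * The interpolation path *)

Section interpolation_point.
Context {R : realType} (J : finType) (k : nat) (theta : 'I_k -> J -> R).
Local Notation I := (J + 'I_k)%type.
Implicit Types (a b : R) (t : I -> R) (r : J) (i j : 'I_k).

(** A family t indexed by J + 'I_k holds the values of the X_r on the left and of
    the Z_j on the right; this is the point a S + b Z. *)
Definition point a b t : 'rV[R]_k :=
  \row_j (a * (\sum_r theta j r * t (inl r)) + b * t (inr j)).

Lemma point_upd_inl a b t r x : point a b (upd t (inl r) x) =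
  \row_j (a * theta j r * x + point a b (upd t (inl r) 0) 0 j).
Proof.
apply/rowP => j; rewrite !mxE addrA; congr (_ + _).
rewrite (bigD1 r)//= [in RHS](bigD1 r)//= /upd eqxx mulr0 add0r mulrDr mulrA.
congr (_ + _ * _); apply: eq_bigr => s /negbTE sr.
by rewrite (inj_eq (@inl_inj _ _)) sr.
Qed.

Lemma point_upd_inr a b t i x : point a b (upd t (inr i) x) =
  \row_j ((if j == i then b else 0) * x + point a b (upd t (inr i) 0) 0 j).
Proof.
apply/rowP => j; rewrite !mxE [RHS]addrCA; congr (_ + _).
rewrite /upd (inj_eq (@inr_inj _ _)).
by case: eqP => _; rewrite ?mulr0 ?mul0r ?addr0 ?add0r.
Qed.

Lemma is_derive_affine (u v x : R) : is_derive x 1 (fun y => u * y + v) u.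
Proof. by apply: is_derive_eq; rewrite -![_ *: _]/(_ * _) mulr1 addr0. Qed.

Lemma continuous_row_comp (f : 'rV[R]_k -> R) (u : 'I_k -> R -> R) (v : 'I_k -> R -> R) :
  continuous f -> (forall j (x : R), is_derive x 1 (u j) (v j x)) ->
  continuous (fun y => f (\row_j u j y)).
Proof.
move=> cf du y.
apply: (@continuous_comp _ _ _ (fun y => \row_j u j y)); last exact: cf.
apply/differentiable_continuous/derivable1_diffP/derivable_mxP => a j.
rewrite (_ : (fun x : R => _) = u j); last by apply/funext => s; rewrite mxE.
by have [] := du j y.
Qed.

Lemma is_derive_point_inl a b t r (f : 'rV[R]_k -> R) (x : R) : partially_C1 f ->
  is_derive x 1 (fun y => f (point a b (upd t (inl r) y)))
    (a * \sum_j theta j r * partial j f (point a b (upd t (inl r) x))).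
Proof.
move=> Cf; pose C := point a b (upd t (inl r) 0).
rewrite (_ : (fun y => _) = fun y => f (\row_j (a * theta j r * y + C 0 j))); last first.
  by apply/funext => y; rewrite point_upd_inl.
have := @partially_C1_chain R k f (fun j y => a * theta j r * y + C 0 j)
  (fun j y => a * theta j r) x Cf (fun j => is_derive_affine _ _ _).
rewrite -point_upd_inl => /is_derive_eq; apply.
by rewrite mulr_sumr; apply: eq_bigr => j _; rewrite mulrA.
Qed.

Lemma is_derive_point_inr a b t i (f : 'rV[R]_k -> R) (x : R) : partially_C1 f ->
  is_derive x 1 (fun y => f (point a b (upd t (inr i) y)))
    (b * partial i f (point a b (upd t (inr i) x))).
Proof.
move=> Cf; pose C := point a b (upd t (inr i) 0).
rewrite (_ : (fun y => _) =
    fun y => f (\row_j ((if j == i then b else 0) * y + C 0 j))); last first.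
  by apply/funext => y; rewrite point_upd_inr.
have := @partially_C1_chain R k f (fun j y => (if j == i then b else 0) * y + C 0 j)
  (fun j y => if j == i then b else 0) x Cf (fun j => is_derive_affine _ _ _).
rewrite -point_upd_inr => /is_derive_eq; apply.
rewrite (bigD1 i)//= eqxx big1 ?addr0// => j /negbTE ->.
by rewrite mul0r.
Qed.

Lemma continuous_point_upd a b t (s : I) (f : 'rV[R]_k -> R) : continuous f ->
  continuous (fun y => f (point a b (upd t s y))).
Proof.
move=> cf; case: s => [r|i].
  rewrite (_ : (fun y => _) = fun y => f (\row_j (a * theta j r * y +
      point a b (upd t (inl r) 0) 0 j))); last first.
    by apply/funext => y; congr (f _); exact: point_upd_inl.
  exact: (@continuous_row_comp f
    (fun j y => a * theta j r * y + point a b (upd t (inl r) 0) 0 j)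
    (fun j _ => a * theta j r) cf (fun j x => is_derive_affine _ _ _)).
rewrite (_ : (fun y => _) = fun y => f (\row_j ((if j == i then b else 0) * y +
    point a b (upd t (inr i) 0) 0 j))); last first.
  by apply/funext => y; congr (f _); exact: point_upd_inr.
exact: (@continuous_row_comp f
  (fun j y => (if j == i then b else 0) * y + point a b (upd t (inr i) 0) 0 j)
  (fun j _ => if j == i then b else 0) cf (fun j x => is_derive_affine _ _ _)).
Qed.

Lemma measurable_point d (T : measurableType d) a b (t : T -> I -> R)
    (f : 'rV[R]_k -> R) : continuous f ->
  (forall s, measurable_fun [set: T] (fun w => t w s)) ->
  measurable_fun [set: T] (fun w => f (point a b (t w))).
Proof.
move=> cf mt; apply: (@measurable_continuous_row _ _ _ _ f
  (fun j w => a * (\sum_r theta j r * t w (inl r)) + b * t w (inr j)) cf) => j.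
apply: measurable_funD; last exact: measurable_funM.
apply: measurable_funM => //; apply: measurable_sum => r.
exact: measurable_funM.
Qed.

Lemma measurable_upd_coord (s s' : I) (x : R) :
  measurable_fun [set: vectors R I] (fun t : vectors R I => upd t s x s').
Proof. by rewrite /upd; case: eqP => // _; exact: measurable_vectors_coord. Qed.

End interpolation_point.

Section smoothing.
Context {R : realType} (J : finType) (k : nat) (theta : 'I_k -> J -> R).
Local Notation I := (J + 'I_k)%type.
Context d (T : measurableType d) (P : probability T R) (Y : I -> T -> R).
Hypothesis mY : forall s, measurable_fun [set: T] (Y s).
Hypothesis iY : independent P Y.
Hypothesis nY : forall i : 'I_k, standard_normal_law P (Y (inr i)).
Variables a b : R.
Local Notation pt := (point theta a b).

(** The map sigma is the identity, or freezes one of the X_r to a given value; it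
    must not touch the Gaussian coordinate that is integrated by parts. *)
Lemma gaussian_ibp_point (i : 'I_k) (sigma : (I -> R) -> I -> R)
    (f : 'rV[R]_k -> R) (B : R) :
  (forall s, measurable_fun [set: vectors R I] (fun t : vectors R I => sigma t s)) ->
  (forall t y, sigma (upd t (inr i) y) = upd (sigma t) (inr i) y) ->
  partially_C1 f -> (forall y, `|f y| <= B) ->
  (forall y, `|b * partial i f y| <= B) ->
  \int[P]_w (Y (inr i) w * f (pt (sigma (Y^~ w)))) =
  \int[P]_w (b * partial i f (pt (sigma (Y^~ w)))).
Proof.
move=> msigma sigmaC Cf fB dfB.
apply: (@gaussian_coordinate_ibp _ _ _ _ P Y mY iY (inr i)
  (fun t => f (pt (sigma t)))
  (fun t => b * partial i f (pt (sigma t))) B) => //.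
- by apply: measurable_point => //; exact: Cf.1.
- by apply: measurable_funM => //; apply: measurable_point => //; exact: (Cf.2 i).2.
- move=> t y; under eq_fun do rewrite sigmaC.
  by rewrite sigmaC; exact: is_derive_point_inr.
- move=> t; under eq_fun do rewrite sigmaC.
  move=> y; apply: cvgM; first exact: cvg_cst.
  by apply: (continuous_point_upd (s := inr i)) ; exact: (Cf.2 i).2.
Qed.

Lemma upd_inlC (t : I -> R) (r : J) (i : 'I_k) (x y : R) :
  upd (upd t (inr i) y) (inl r) x = upd (upd t (inl r) x) (inr i) y.
Proof. by apply/funext => -[s|s]; rewrite /upd//=; case: eqP => // ->. Qed.

End smoothing.

(** * Replacing one summand *)

Section replacement.
Context {R : realType} (J : finType) (k : nat) (theta : 'I_k -> J -> R).
Local Notation I := (J + 'I_k)%type.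
Context d (T : measurableType d) (P : probability T R) (Y : I -> T -> R).
Hypothesis mY : forall s, measurable_fun [set: T] (Y s).
Hypothesis iY : independent P Y.
Hypothesis nY : forall i : 'I_k, standard_normal_law P (Y (inr i)).
Variables a b : R.
Hypothesis b0 : 0 < b.
Local Notation pt := (point theta a b).
Variables (f : 'rV[R]_k -> R) (B H : R).
Hypothesis Cf : partially_C1 f.
Hypothesis fB : forall y, `|f y| <= B.
Hypothesis dfH : forall j y, `|partial j f y| <= H.
Variable r : J.
Let s := \sum_j `|theta j r|.
Let V x w := pt (upd (Y^~ w) (inl r) x).
Let phi x := \int[P]_w f (V x w).
Let dphi x := \int[P]_w (a * \sum_j theta j r * partial j f (V x w)).
Let e1 : R := 2 / Num.sqrt (pi *+ 2).

Let B0 : 0 <= B. Proof. exact: le_trans (fB 0). Qed.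

Let mV (h : 'rV[R]_k -> R) x : continuous h ->
  measurable_fun [set: T] (fun w => h (V x w)).
Proof.
move=> ch; apply: (@measurable_point _ _ _ theta _ T a b
  (fun w => upd (Y^~ w) (inl r) x) h ch) => s'.
by rewrite /upd; case: eqP.
Qed.

Let jf x : P.-integrable [set: T] (EFin \o (fun w => f (V x w))).
Proof. exact: (@integrable_bounded _ _ _ P _ B (mV x Cf.1) (fun w => fB _)). Qed.

Let jdf x j : P.-integrable [set: T] (EFin \o (fun w => partial j f (V x w))).
Proof.
exact: (@integrable_bounded _ _ _ P _ H (mV x (Cf.2 j).2) (fun w => dfH _ _)).
Qed.

Let jZ (c : R) (h : T -> R) : P.-integrable [set: T] (EFin \o h) ->
  P.-integrable [set: T] (EFin \o (fun w => c * h w)).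
Proof. by move=> jh; have := integrableZl measurableT c jh. Qed.

(* the derivative in the value of X_r; s is the l1-norm of v_r *)
Let slope (t : I -> R) x :
  `|a * \sum_j theta j r * partial j f (pt (upd t (inl r) x))| <= `|a| * s * H.
Proof.
rewrite normrM -mulrA ler_wpM2l// mulr_suml (le_trans (ler_norm_sum _ _ _))//.
by apply: ler_sum => j _; rewrite normrM ler_wpM2l.
Qed.

Lemma is_derive_phi (x : R) : is_derive x 1 phi (dphi x).
Proof.
apply: (@is_derive_Rintegral _ _ _ P (fun x w => f (V x w))
  (fun x w => a * \sum_j theta j r * partial j f (V x w)) (fun=> `|a| * s * H)) => //.
- by move=> y w; exact: is_derive_point_inl.
- exact: finite_measure_integrable_cst.
- by move=> y w; exact: slope.
Qed.

(* trading a derivative of f for a Gaussian weight and a factor b *)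
Let dphiE x : b * dphi x =
  a * \sum_j theta j r * \int[P]_w (Y (inr j) w * f (V x w)).
Proof.
have jsum : P.-integrable [set: T]
    (EFin \o (fun w => \sum_j theta j r * partial j f (V x w))).
  by apply: integrable_sumr => j; exact: jZ.
rewrite /dphi RintegralZl// Rintegral_sumr; last by move=> j; exact: jZ.
rewrite mulrCA; congr (a * _); rewrite mulr_sumr; apply: eq_bigr => j _.
rewrite RintegralZl// mulrCA; congr (_ * _); rewrite -RintegralZl//.
pose C := B + b * H.
have H0 : 0 <= H by exact: le_trans (dfH j 0).
have := @gaussian_ibp_point _ _ _ theta _ _ P Y mY iY nY a b j
  (fun t => upd t (inl r) x) f C.
move=> -> //.
- by move=> s'; exact: measurable_upd_coord.
- by move=> t y; exact: upd_inlC.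
- by move=> y; rewrite (le_trans (fB y))// /C lerDl mulr_ge0// ltW.
- by move=> y; rewrite normrM (ger0_norm (ltW b0)) /C ler_wpDl// ler_wpM2l// ltW.
Qed.

(** In dphiE only f itself is left, and it varies by at most |a| s H per unit of
    X_r; the Gaussian weight contributes its absolute moment e1. *)
Lemma dphi_lipschitz x y :
  `|dphi x - dphi y| <= a ^+ 2 / b * H * e1 * s ^+ 2 * `|x - y|.
Proof.
have H0 (j : 'I_k) : 0 <= H by exact: le_trans (dfH j 0).
have s0 : 0 <= s by exact: sumr_ge0.
have jY j := gaussian_integrable (mY (inr j)) (nY j).
have jYf j z : P.-integrable [set: T] (EFin \o (fun w => Y (inr j) w * f (V z w))).
  by apply: (integrable_mul_bounded (jY j) (M := B)) => //; exact: (mV _ Cf.1).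
have bound j : `|\int[P]_w (Y (inr j) w * f (V x w)) -
    \int[P]_w (Y (inr j) w * f (V y w))| <= e1 * (`|a| * s * H * `|x - y|).
  rewrite -RintegralB//.
  have jD : P.-integrable [set: T] (EFin \o (fun w =>
      Y (inr j) w * f (V x w) - Y (inr j) w * f (V y w))).
    by have := integrableB measurableT (jYf j x) (jYf j y).
  apply: (le_trans (le_normr_Rintegral measurableT jD)).
  have jN := integrable_norm (jY j).
  have -> : e1 = \int[P]_w `|Y (inr j) w|.
    by rewrite /Rintegral (gaussian_abs_moment (mY (inr j)) (nY j)).
  rewrite -RintegralZr//; apply: le_Rintegral => //.
  - exact: integrable_norm jD.
  - by have := integrableZr measurableT (`|a| * s * H * `|x - y|) jN.
  - move=> w _; rewrite -mulrBr normrM ler_wpM2l//.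
    apply: (@lipschitz_of_derive _ (fun z => f (V z w))
      (fun z => a * \sum_j theta j r * partial j f (V z w))).
      by move=> z; exact: is_derive_point_inl.
    by move=> z; exact: slope.
have E : b * `|dphi x - dphi y| = `|a| * `|\sum_j (
    theta j r * \int[P]_w (Y (inr j) w * f (V x w)) -
    theta j r * \int[P]_w (Y (inr j) w * f (V y w)))|.
  have dE : b * (dphi x - dphi y) = a * \sum_j (
      theta j r * \int[P]_w (Y (inr j) w * f (V x w)) -
      theta j r * \int[P]_w (Y (inr j) w * f (V y w))).
    rewrite sumrB [LHS]mulrBr [RHS]mulrBr.
    exact: (congr2 (fun u v => u - v) (dphiE x) (dphiE y)).
  by rewrite -normrM -dE normrM (gtr0_norm b0).
rewrite -(ler_pM2l b0) E.
have -> : b * (a ^+ 2 / b * H * e1 * s ^+ 2 * `|x - y|) =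
    `|a| * (s * (e1 * (`|a| * s * H * `|x - y|))).
  have -> : a ^+ 2 = `|a| ^+ 2 by rewrite real_normK// num_real.
  by field; rewrite gt_eqF.
rewrite ler_wpM2l// [in leRHS]/s mulr_suml (le_trans (ler_norm_sum _ _ _))//.
by apply: ler_sum => j _; rewrite -mulrBr normrM ler_wpM2l.
Qed.

Hypothesis jX : P.-integrable [set: T] (EFin \o Y (inl r)).
Hypothesis X0 : \int[P]_w Y (inl r) w = 0.
Hypothesis jX2 : P.-integrable [set: T] (EFin \o (fun w => Y (inl r) w ^+ 2)).
Hypothesis X1 : \int[P]_w (Y (inl r) w ^+ 2) = 1.
Hypothesis H0 : 0 <= H.

(** By independence, the two expectations are E[X_r phi(X_r)] and
    E[phi'(X_r)]. *)
Lemma replacement_bound :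
  (`|\int[P]_w (Y (inl r) w * f (pt (Y^~ w))) -
     \int[P]_w (a * \sum_j theta j r * partial j f (pt (Y^~ w)))|%:E <=
   (3 / 2 * (a ^+ 2 / b * H * e1 * s ^+ 2))%:E *
   \int[P]_w (`|Y (inl r) w| ^+ 3)%:E)%E.
Proof.
have e10 : 0 <= e1 by rewrite divr_ge0.
have mpt (h : 'rV[R]_k -> R) : continuous h ->
    measurable_fun [set: vectors R I] (fun t : vectors R I => h (pt t)).
  by move=> ch; apply: measurable_point => // s'; exact: measurable_vectors_coord.
have mptY (h : 'rV[R]_k -> R) : continuous h ->
    measurable_fun [set: T] (fun w => h (pt (Y^~ w))).
  by move=> ch; apply: measurable_point.
have msum : measurable_fun [set: vectors R I]
    (fun t : vectors R I => a * \sum_j theta j r * partial j f (pt t)).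
  apply: measurable_funM => //; apply: measurable_sum => j.
  by apply: measurable_funM => //; exact: (mpt _ (Cf.2 j).2).
have msumY : measurable_fun [set: T]
    (fun w => a * \sum_j theta j r * partial j f (pt (Y^~ w))).
  apply: measurable_funM => //; apply: measurable_sum => j.
  by apply: measurable_funM => //; exact: (mptY _ (Cf.2 j).2).
have msumV x : measurable_fun [set: T]
    (fun w => a * \sum_j theta j r * partial j f (V x w)).
  apply: measurable_funM => //; apply: measurable_sum => j.
  by apply: measurable_funM => //; exact: (mV _ (Cf.2 j).2).
have slope0 w : `|a * \sum_j theta j r * partial j f (pt (Y^~ w))| <= `|a| * s * H.
  have -> : Y^~ w = upd (Y^~ w) (inl r) (Y (inl r) w).
    by apply/funext => s'; rewrite /upd; case: eqP => // ->.
  exact: slope.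
have -> : \int[P]_w (Y (inl r) w * f (pt (Y^~ w))) =
    \int[P]_w (Y (inl r) w * phi (Y (inl r) w)).
  rewrite (@resample_outer _ _ _ _ P Y mY iY (inl r)
    (fun t => t (inl r) * f (pt t))).
  - apply: eq_Rintegral => w' _; rewrite /phi -RintegralZl//.
    by apply: eq_Rintegral => w _; rewrite /upd eqxx.
  - by apply: measurable_funM; [exact: measurable_vectors_coord|exact: (mpt _ Cf.1)].
  - by apply: (integrable_mul_bounded jX (M := B)) => //; exact: (mptY _ Cf.1).
  - by move=> w'; rewrite /upd/= eqxx; exact: (jZ _ (jf (Y (inl r) w'))).
have -> : \int[P]_w (a * \sum_j theta j r * partial j f (pt (Y^~ w))) =
    \int[P]_w dphi (Y (inl r) w).
  rewrite (@resample_outer _ _ _ _ P Y mY iY (inl r)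
    (fun t => a * \sum_j theta j r * partial j f (pt t))) => //.
    by apply: (@integrable_bounded _ _ _ P _ (`|a| * s * H)).
  move=> w'; apply: (@integrable_bounded _ _ _ P _ (`|a| * s * H)).
    exact: (msumV (Y (inl r) w')).
  by move=> w; exact: (slope (Y^~ w) (Y (inl r) w')).
have phiB x : `|phi x| <= B + `|a| * s * H.
  rewrite (@le_trans _ _ B)//.
    by apply: norm_Rintegral_le => //; exact: (mV _ Cf.1).
  by rewrite lerDl !mulr_ge0// sumr_ge0.
have dphiB x : `|dphi x| <= B + `|a| * s * H.
  rewrite (@le_trans _ _ (`|a| * s * H))//; last by rewrite lerDr.
  exact: (@norm_Rintegral_le _ _ _ P _ _ (msumV x) (fun w => slope (Y^~ w) x)).
apply: (centered_unit_variance_ibp (mY (inl r)) jX X0 jX2 X1 _ is_derive_phi _ _ phiB dphiB).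
- by do 3 (apply: mulr_ge0; last by rewrite ?sqr_ge0 ?e10);
     apply: mulr_ge0; rewrite ?sqr_ge0 ?invr_ge0 ?ltW.
- exact: lipschitz_continuous_real dphi_lipschitz.
- by move=> x; have := dphi_lipschitz x 0; rewrite subr0.
Qed.

End replacement.

(** * The derivative along the path *)

Section path.
Context {R : realType} (J : finType) (k : nat) (theta : 'I_k -> J -> R).
Local Notation I := (J + 'I_k)%type.
Hypothesis orth : forall i j, \sum_r theta i r * theta j r = (i == j)%:R.
Context d (T : measurableType d) (P : probability T R) (Y : I -> T -> R).
Hypothesis mY : forall s, measurable_fun [set: T] (Y s).
Hypothesis iY : independent P Y.
Hypothesis nY : forall i : 'I_k, standard_normal_law P (Y (inr i)).
Hypothesis jX : forall r, P.-integrable [set: T] (EFin \o Y (inl r)).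
Hypothesis X0 : forall r, \int[P]_w Y (inl r) w = 0.
Hypothesis jX2 : forall r, P.-integrable [set: T] (EFin \o (fun w => Y (inl r) w ^+ 2)).
Hypothesis X1 : forall r, \int[P]_w (Y (inl r) w ^+ 2) = 1.
Variable m3 : \bar R.
Hypothesis X3 : forall r, (\int[P]_w (`|Y (inl r) w| ^+ 3)%:E = m3)%E.
Hypothesis m30 : (0 <= m3)%E.
Variables (g : 'rV[R]_k -> R) (B H : R).
Hypothesis C2g : C2 g.
Hypothesis gB : forall y, `|g y| <= B.
Hypothesis dgB : forall i y, `|partial i g y| <= B.
Hypothesis ddgB : forall i j y, `|partial i (partial j g) y| <= H.
Hypothesis H0 : 0 <= H.

Let e1 : R := 2 / Num.sqrt (pi *+ 2).
Let e10 : 0 <= e1. Proof. by rewrite divr_ge0. Qed.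
Let S j w := \sum_r theta j r * Y (inl r) w.
Let Z j w := Y (inr j) w.
Let pt a b w := point theta a b (Y^~ w).
Let F (x : R) := \int[P]_w g (pt (sin x) (cos x) w).
Let dF (x : R) := \int[P]_w
  \sum_j (cos x * S j w - sin x * Z j w) * partial j g (pt (sin x) (cos x) w).

Let B0 : 0 <= B. Proof. exact: le_trans (gB 0). Qed.

Let mpt (h : 'rV[R]_k -> R) a b : continuous h ->
  measurable_fun [set: T] (fun w => h (pt a b w)).
Proof.
by move=> ch; apply: (@measurable_point _ _ _ theta _ T a b (fun w => Y^~ w) h ch).
Qed.

Let jZ j : P.-integrable [set: T] (EFin \o Z j).
Proof. exact: (gaussian_integrable (mY (inr j)) (nY j)). Qed.

Let jscale (c : R) (h : T -> R) : P.-integrable [set: T] (EFin \o h) ->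
  P.-integrable [set: T] (EFin \o (fun w => c * h w)).
Proof. by move=> jh; have := integrableZl measurableT c jh. Qed.

Let jS j : P.-integrable [set: T] (EFin \o S j).
Proof. by apply: integrable_sumr => r; exact: jscale. Qed.

Lemma is_derive_path (x : R) : is_derive x 1 F (dF x).
Proof.
apply: (@is_derive_Rintegral _ _ _ P (fun x w => g (pt (sin x) (cos x) w))
  (fun x w => \sum_j (cos x * S j w - sin x * Z j w) *
     partial j g (pt (sin x) (cos x) w))
  (fun w => \sum_j (`|S j w| + `|Z j w|) * B)).
- move=> y.
  exact: (@integrable_bounded _ _ _ P _ B (mpt _ _ C2g.1.1) (fun w => gB _)).
- move=> y w.
  apply: (@partially_C1_chain R k g (fun j z => sin z * S j w + cos z * Z j w)
   (fun j z => cos z * S j w - sin z * Z j w) y C2g.1) => j.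
  apply: is_derive_eq; rewrite -![_ *: _]/(_ * _).
  by ring.
- apply: integrable_sumr => j.
  have := integrableZr measurableT B (integrableD measurableT
    (integrable_norm (jS j)) (integrable_norm (jZ j))).
  by [].
- move=> y w; rewrite (le_trans (ler_norm_sum _ _ _))//.
  apply: ler_sum => j _; rewrite normrM ler_pM//.
  rewrite (le_trans (ler_normB _ _))// !normrM lerD//.
    by rewrite ler_piMl// ler_norml cos_geN1 cos_le1.
  by rewrite ler_piMl// ler_norml sin_geN1 sin_le1.
Qed.

Let s r := \sum_j `|theta j r|.
Let D a b j r := \int[P]_w (Y (inl r) w * partial j g (pt a b w)) -
  \int[P]_w (a * \sum_l theta l r * partial l (partial j g) (pt a b w)).

Let jddg a b l j : P.-integrable [set: T]
  (EFin \o (fun w => partial l (partial j g) (pt a b w))).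
Proof.
exact: (@integrable_bounded _ _ _ P _ H (mpt a b ((C2g.2 j).2 l).2) (fun w => ddgB _ _ _)).
Qed.

Let jXdg a b r j : P.-integrable [set: T]
  (EFin \o (fun w => Y (inl r) w * partial j g (pt a b w))).
Proof.
exact: (integrable_mul_bounded (jX r) (mpt a b (C2g.1.2 j).2) (fun w => dgB _ _)).
Qed.

Let jZdg a b j : P.-integrable [set: T]
  (EFin \o (fun w => Z j w * partial j g (pt a b w))).
Proof.
exact: (integrable_mul_bounded (jZ j) (mpt a b (C2g.1.2 j).2) (fun w => dgB _ _)).
Qed.

(** The Gaussian part of the derivative is - a b times the expected Laplacian, which
    orthonormality distributes over the X_r. *)
Lemma path_derivative_split a b : 0 < b ->
  \int[P]_w \sum_j (b * S j w - a * Z j w) * partial j g (pt a b w) =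
  b * \sum_j \sum_r theta j r * D a b j r.
Proof.
move=> b0.
have E w : \sum_j (b * S j w - a * Z j w) * partial j g (pt a b w) =
    \sum_j (b * (\sum_r theta j r * (Y (inl r) w * partial j g (pt a b w))) -
      a * (Z j w * partial j g (pt a b w))).
  apply: eq_bigr => j _; rewrite mulrBl -!mulrA; congr (_ * _ - _).
  by rewrite mulr_suml; apply: eq_bigr => r _; rewrite mulrA.
under eq_Rintegral do rewrite E.
have jsum j : P.-integrable [set: T] (EFin \o (fun w =>
    \sum_r theta j r * (Y (inl r) w * partial j g (pt a b w)))).
  by apply: integrable_sumr => r; exact: jscale.
have jB (h1 h2 : T -> R) : P.-integrable [set: T] (EFin \o h1) ->
    P.-integrable [set: T] (EFin \o h2) ->
    P.-integrable [set: T] (EFin \o (fun w => h1 w - h2 w)).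
  by move=> jh1 jh2; have := integrableB measurableT jh1 jh2.
rewrite Rintegral_sumr; last by move=> j; apply: jB; exact: jscale.
have Zj j : \int[P]_w (Z j w * partial j g (pt a b w)) =
    b * \int[P]_w partial j (partial j g) (pt a b w).
  rewrite -[RHS](RintegralZl b measurableT (jddg a b j j)).
  apply: (@gaussian_ibp_point _ _ _ theta _ _ P Y mY iY nY a b j id
    (partial j g) (B + b * H)) => //.
  - by move=> s'; exact: measurable_vectors_coord.
  - exact: (C2g.2 j).
  - by move=> y; rewrite (le_trans (dgB j y))// lerDl mulr_ge0// ltW.
  - by move=> y; rewrite normrM (ger0_norm (ltW b0)) ler_wpDl// ler_wpM2l// ltW.
under eq_bigr => j _.
  rewrite RintegralB//; [|exact: jscale|exact: jscale].
  rewrite !RintegralZl// Rintegral_sumr; last by move=> r; exact: jscale.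
  rewrite Zj.
  under eq_bigr => r _ do rewrite RintegralZl//.
  rewrite mulrCA -mulrBr.
  over.
rewrite -mulr_sumr; congr (b * _).
have DE j r : D a b j r = \int[P]_w (Y (inl r) w * partial j g (pt a b w)) -
    a * \sum_l theta l r * \int[P]_w partial l (partial j g) (pt a b w).
  rewrite /D; congr (_ - _).
  have jsl : P.-integrable [set: T] (EFin \o (fun w =>
      \sum_l theta l r * partial l (partial j g) (pt a b w))).
    by apply: integrable_sumr => l; exact: jscale.
  rewrite RintegralZl// Rintegral_sumr; last by move=> l; exact: jscale.
  by congr (_ * _); apply: eq_bigr => l _; rewrite RintegralZl.
apply: eq_bigr => j _.
under [in RHS]eq_bigr => r _ do rewrite DE mulrBr.
rewrite sumrB; congr (_ - _).
under [in RHS]eq_bigr => r _ do rewrite mulrCA mulr_sumr.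
rewrite -mulr_sumr; congr (a * _); rewrite exchange_big/=.
rewrite (bigD1 j)//= [X in _ + X]big1 ?addr0.
  under eq_bigr => r _ do rewrite mulrA.
  by rewrite -mulr_suml orth eqxx mul1r.
move=> l lj; under eq_bigr => r _ do rewrite mulrA.
by rewrite -mulr_suml orth eq_sym (negbTE lj) mul0r.
Qed.

(* e1 is E|Z_j| and s r is the l1-norm of v_r *)
Let kappa := 3 / 2 * e1 * H * \sum_r s r ^+ 3.

(** The singular factor 1 / cos x of replacement_bound is compensated by the
    factor cos x in front of the X_r. *)
Lemma path_derivative_bound (x : R) : 0 < cos x ->
  (`|dF x|%:E <= (sin x ^+ 2)%:E * (kappa%:E * m3))%E.
Proof.
move=> b0; rewrite /dF path_derivative_split//.
set a := sin x; set b := cos x in b0 *.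
have Db j r : (`|D a b j r|%:E <=
    (3 / 2 * (a ^+ 2 / b * H * e1 * s r ^+ 2))%:E * m3)%E.
  rewrite -(X3 r).
  exact: (@replacement_bound _ _ _ theta _ _ P Y mY iY nY a b b0 (partial j g) B H
    (C2g.2 j) (dgB j) (fun l => ddgB l j) r (jX r) (X0 r) (jX2 r) (X1 r) H0).
have c0 r : 0 <= 3 / 2 * (a ^+ 2 / b * H * e1 * s r ^+ 2).
  have := sqr_ge0 (s r); have := sqr_ge0 a; have : 0 <= b^-1 by rewrite invr_ge0 ltW.
  move=> h1 h2 h3; apply: mulr_ge0 => //.
  by do 3 (apply: mulr_ge0 => //); apply: mulr_ge0.
pose w (q : 'I_k * J) := b * `|theta q.1 q.2|.
have w0 q : 0 <= w q by rewrite /w mulr_ge0// ltW.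
pose c r := 3 / 2 * (a ^+ 2 / b * H * e1 * s r ^+ 2).
have r1 : `|b * \sum_j \sum_r theta j r * D a b j r| <=
    \sum_q w q * `|D a b q.1 q.2|.
  rewrite normrM (gtr0_norm b0) pair_bigA/= (le_trans (ler_wpM2l (ltW b0) (ler_norm_sum _ _ _)))//.
  rewrite mulr_sumr; apply: ler_sum => q _.
  by rewrite normrM mulrA.
have -> : ((a ^+ 2)%:E * (kappa%:E * m3) = (\sum_q w q * c q.2)%:E * m3)%E.
  rewrite muleA -EFinM; congr (_%:E * _)%E.
  rewrite -(pair_bigA _ (fun j r => w (j, r) * c r))/= exchange_big/=.
  rewrite /kappa mulrA mulr_sumr; apply: eq_bigr => r _.
  rewrite -mulr_suml /w/= -mulr_sumr /c -/(s r).
  by field; rewrite gt_eqF.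
apply: (@le_trans _ _ (\sum_q (w q * `|D a b q.1 q.2|)%:E)%E).
  by rewrite sumEFin lee_fin.
rewrite -sumEFin ge0_sume_distrl; last first.
  by move=> q _; rewrite lee_fin; apply: mulr_ge0; [exact: w0|exact: c0].
apply: lee_sum => q _.
rewrite (EFinM (w q) `|_|) (EFinM (w q) (c q.2)) -muleA.
by apply: lee_wpmul2l; [rewrite lee_fin; exact: w0|exact: Db].
Qed.

(** The function q (x - sin x cos x) / 2 has derivative q (sin x)^2, and an
    infinite right-hand side leaves nothing to prove. *)
Lemma smart_path_bound :
  (`|\int[P]_w g (\row_j S j w) - \int[P]_w g (\row_j Z j w)|%:E <=
   (pi / 4)%:E * (kappa%:E * m3))%E.
Proof.
have kappa0 : 0 <= kappa.
  rewrite /kappa; apply: mulr_ge0; last first.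
    by apply: sumr_ge0 => r _; rewrite exprn_ge0// sumr_ge0.
  by apply: mulr_ge0 => //; apply: mulr_ge0.
have F1 : \int[P]_w g (\row_j S j w) = F (pi / 2).
  rewrite /F sin_pihalf cos_pihalf; apply: eq_Rintegral => w _; congr (g _).
  by apply/rowP => j; rewrite !mxE mul1r mul0r addr0.
have F0 : \int[P]_w g (\row_j Z j w) = F 0.
  rewrite /F sin0 cos0; apply: eq_Rintegral => w _; congr (g _).
  by apply/rowP => j; rewrite !mxE mul1r mul0r add0r.
rewrite F1 F0.
have q0 : (0 <= kappa%:E * m3)%E by rewrite mule_ge0.
have := path_derivative_bound; case: (kappa%:E * m3)%E q0 => [q| |] // q0 dFq.
  rewrite -EFinM lee_fin.
  pose G (x : R) := q * ((x - sin x * cos x) / 2).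
  have dG (x : R) : is_derive x 1 G (sin x ^+ 2 * q).
    apply: is_derive_eq; rewrite -![_ *: _]/(_ * _).
    have -> : cos x * cos x = 1 - sin x ^+ 2 by rewrite -(cos2Dsin2 x); ring.
    by field.
  have pi0 : 0 <= pi / 2 :> R by rewrite divr_ge0// pi_ge0.
  have -> : pi / 4 * q = G (pi / 2) - G 0.
    by rewrite /G sin_pihalf cos_pihalf sin0 mulr0 mul0r !subr0; field.
  apply: (norm_increment_le is_derive_path dG pi0) => x /andP[x0 xpi].
  have := dFq x; rewrite -EFinM lee_fin; apply.
  by rewrite cos_gt0_pihalf// xpi andbT (lt_trans _ x0)// oppr_lt0 divr_gt0// pi_gt0.
by rewrite gt0_muley ?leey// lte_fin divr_gt0// pi_gt0.
Qed.

(** With q = sqrt (2 pi) the left-hand side is 3/8 q, and q <= 3 because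
    pi <= 4. *)
Lemma smart_path_constant : pi / 4 * (3 / 2 * e1) <= 4 / 3 :> R.
Proof.
have pi4 : pi <= 4 :> R.
  have := @pihalf_lt2 R; rewrite ltr_pdivrMr// => /ltW.
  by rewrite -natrM.
pose q : R := Num.sqrt (pi *+ 2).
have q0 : 0 < q by rewrite sqrtr_gt0 pmulrn_lgt0// pi_gt0.
have q2 : q ^+ 2 = pi *+ 2 by rewrite sqr_sqrtr// mulrn_wge0// pi_ge0.
have q3 : q <= 3.
  rewrite -(@ler_pXn2r _ 2)// ?nnegrE ?(ltW q0)// q2.
  by rewrite -mulr_natr; lra.
have -> : pi = q ^+ 2 / 2 :> R by rewrite q2 -mulr_natr; field.
have -> : q ^+ 2 / 2 / 4 * (3 / 2 * e1) = 3 / 8 * q.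
  by rewrite /e1 -/q; field; rewrite gt_eqF.
lra.
Qed.

End path.

(** * Transfer to a product space *)

(** Used both for the projections of a product space and for identically
    distributed variables. *)
Section equal_law.
Context {R : realType} d d1 d2 (S : measurableType d) (T1 : measurableType d1)
  (T2 : measurableType d2) (P1 : probability T1 R) (P2 : probability T2 R).
Variables (u1 : T1 -> S) (u2 : T2 -> S).
Hypothesis mu1 : measurable_fun [set: T1] u1.
Hypothesis mu2 : measurable_fun [set: T2] u2.
Hypothesis law : forall A, measurable A -> P1 (u1 @^-1` A) = P2 (u2 @^-1` A).
Variable f : S -> R.
Hypothesis mf : measurable_fun [set: S] f.

Let mf' (h : S -> R) : measurable_fun [set: S] h -> measurable_fun [set: S] (EFin \o h).
Proof. by move=> mh; exact/measurable_EFinP. Qed.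

Let ge0_equal_law (h : S -> R) : measurable_fun [set: S] h -> (forall x, 0 <= h x) ->
  (\int[P1]_w (h (u1 w))%:E = \int[P2]_w (h (u2 w))%:E)%E.
Proof.
move=> mh h0.
have h0' x : x \in [set: S] -> (0 <= (EFin \o h) x)%E by rewrite lee_fin.
have := ge0_integral_pushforward mu1 P1 measurableT (mf' mh) h0'.
rewrite preimage_setT => <-.
have := ge0_integral_pushforward mu2 P2 measurableT (mf' mh) h0'.
rewrite preimage_setT => <-.
by apply: eq_measure_integral => A mA _; exact: law.
Qed.

Lemma equal_law_ge0 : (forall x, 0 <= f x) ->
  (\int[P1]_w (f (u1 w))%:E = \int[P2]_w (f (u2 w))%:E)%E.
Proof. exact: ge0_equal_law. Qed.

Lemma equal_law_integrable : P2.-integrable [set: T2] (EFin \o (f \o u2)) ->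
  P1.-integrable [set: T1] (EFin \o (f \o u1)).
Proof.
move=> /integrableP[_ j]; apply/integrableP; split.
  by apply/measurable_EFinP; exact: measurableT_comp.
move: j; rewrite -(@ge0_equal_law (fun x => `|f x|))//.
exact: measurableT_comp.
Qed.

Lemma equal_law_Rintegral : P2.-integrable [set: T2] (EFin \o (f \o u2)) ->
  \int[P1]_w f (u1 w) = \int[P2]_w f (u2 w).
Proof.
move=> j2; have j1 := equal_law_integrable j2.
rewrite /Rintegral; congr fine.
have := integral_pushforward mu1 (mf' mf) j1 measurableT.
rewrite preimage_setT => <-.
have := integral_pushforward mu2 (mf' mf) j2 measurableT.
rewrite preimage_setT => <-.
by apply: eq_measure_integral => A mA _; exact: law.
Qed.

End equal_law.

Section product_probability.
Context {R : realType} d d' (T : measurableType d) (T' : measurableType d').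
Variables (P : probability T R) (Q : probability T' R).

Definition product_probability : set (T * T') -> \bar R := (P \x Q)%E.

HB.instance Definition _ := Measure.on product_probability.

Let product_probability_setT : product_probability [set: T * T'] = 1%E.
Proof.
rewrite -setXTT /product_probability product_measure1E//.
by rewrite [X in (X * _)%E]probability_setT [X in (_ * X)%E]probability_setT mule1.
Qed.

HB.instance Definition _ := Measure_isProbability.Build _ _ _
  product_probability product_probability_setT.

Lemma product_probability_fst (A : set T) : measurable A ->
  product_probability (fst @^-1` A) = P A.
Proof.
move=> mA; have -> : fst @^-1` A = A `*` [set: T'].
  by apply/seteqP; split => [z ? //|z [] //].
rewrite /product_probability product_measure1E//.
by rewrite [X in (_ * X)%E]probability_setT mule1.
Qed.

Lemma product_probability_snd (A : set T') : measurable A ->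
  product_probability (snd @^-1` A) = Q A.
Proof.
move=> mA; have -> : snd @^-1` A = [set: T] `*` A.
  by apply/seteqP; split => [z ? //|z [] //].
rewrite /product_probability product_measure1E//.
by rewrite [X in (X * _)%E]probability_setT mul1e.
Qed.

Definition juxtapose (I I' : Type) (X : I -> T -> R) (Z : I' -> T' -> R)
    (s : I + I') : T * T' -> R :=
  match s with inl r => X r \o fst | inr i => Z i \o snd end.

Lemma independent_juxtapose (I I' : finType) (X : I -> T -> R) (Z : I' -> T' -> R) :
  (forall r, measurable_fun [set: T] (X r)) ->
  (forall i, measurable_fun [set: T'] (Z i)) ->
  independent P X -> independent Q Z ->
  independent product_probability (juxtapose X Z).
Proof.
move=> mX mZ iX iZ A mA.
have mXA r : measurable (X r @^-1` A (inl r)).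
  by rewrite -[X in measurable X]setTI; apply: mX => //; exact: mA.
have mZA i : measurable (Z i @^-1` A (inr i)).
  by rewrite -[X in measurable X]setTI; apply: mZ => //; exact: mA.
have -> : [set z | forall s, A s (juxtapose X Z s z)] =
    [set w | forall r, A (inl r) (X r w)] `*` [set w | forall i, A (inr i) (Z i w)].
  apply/seteqP; split => [z H|z [H1 H2] [r|i]]; last 2 first.
  - exact: H1.
  - exact: H2.
  by split => [r|i]; [exact: (H (inl r))|exact: (H (inr i))].
rewrite [LHS](product_measure1E P Q); last 2 first.
- have -> : [set w | forall r, A (inl r) (X r w)] =
      \bigcap_(r in [set: I]) (X r @^-1` A (inl r)).
    by apply/seteqP; split => [w H r _|w H r]; exact: H.
  by apply: fin_bigcap_measurable.
- have -> : [set w | forall i, A (inr i) (Z i w)] =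
      \bigcap_(i in [set: I']) (Z i @^-1` A (inr i)).
    by apply/seteqP; split => [w H r _|w H r]; exact: H.
  by apply: fin_bigcap_measurable.
rewrite [X in (X * _)%E](iX (fun r => A (inl r)) (fun r => mA (inl r))).
rewrite [X in (_ * X)%E](iZ (fun i => A (inr i)) (fun i => mA (inr i))).
rewrite [RHS]big_sumType/=; congr (_ * _)%E; apply: eq_bigr => s _.
  exact/esym/(product_probability_fst (mXA s)).
exact/esym/(product_probability_snd (mZA s)).
Qed.

End product_probability.

Lemma mutual_independence_independent {R : realType} d (T : measurableType d)
    (P : probability T R) (I : finType) (X : I -> {RV P >-> R}) :
  mutual_independence X -> independent P (fun i => X i : T -> R).
Proof.
move=> iX A mA.
rewrite (eq_bigl (fun i => i \in [set: I]%SET)) => [|i]; last by rewrite inE.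
rewrite -(iX [set: I]%SET A mA); congr (P _).
by apply/seteqP; split => [w H i _|w H i]; apply: H => //=; rewrite inE.
Qed.

(** * The bound *)

(** The cube lies above its tangent at the mean m of the x_i; summing the tangent
    inequalities, the linear terms collapse. *)
Lemma cube_sum_le {R : realType} (k : nat) (x : 'I_k -> R) :
  (forall i, 0 <= x i) ->
  (\sum_i x i) ^+ 3 <= k%:R ^+ 2 * \sum_i x i ^+ 3.
Proof.
case: (eqVneq k 0%N) x => [->|k0] x x0.
  by rewrite big_ord0 expr0n/= mulr_ge0// ?exprn_ge0// big_ord0.
have kp : 0 < k%:R :> R by rewrite ltr0n lt0n.
set S := \sum_i x i; pose m := S / k%:R.
have S0 : 0 <= S by apply: sumr_ge0.
have m0 : 0 <= m by rewrite divr_ge0// ltW.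
have tangent i : 3 * m ^+ 2 * x i - 2 * m ^+ 3 <= x i ^+ 3.
  rewrite -subr_ge0.
  have -> : x i ^+ 3 - (3 * m ^+ 2 * x i - 2 * m ^+ 3) =
      (x i - m) ^+ 2 * (x i + 2 * m) by ring.
  by rewrite mulr_ge0 ?sqr_ge0// addr_ge0// mulr_ge0.
have : k%:R * m ^+ 3 <= \sum_i x i ^+ 3.
  apply: le_trans (ler_sum _ (fun i _ => tangent i)).
  rewrite sumrB -mulr_sumr -/S sumr_const card_ord -mulr_natr.
  have -> : S = k%:R * m by rewrite /m; field; rewrite gt_eqF.
  by rewrite le_eqVlt; apply/orP; left; apply/eqP; ring.
move=> /(ler_wpM2l (sqr_ge0 k%:R)); apply: le_trans.
rewrite /m le_eqVlt; apply/orP; left; apply/eqP.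
by field; rewrite gt_eqF.
Qed.

Lemma pnorm3_cube {R : realType} (n : nat) (u : 'rV[R]_n) :
  pnorm 3 u ^+ 3 = \sum_r `|u 0 r| ^+ 3.
Proof.
rewrite /pnorm -powR_mulrn ?powR_ge0// -powRrM mulVf// powRr1; last first.
  by apply: sumr_ge0 => r _; exact: powR_ge0.
by apply: eq_bigr => r _; rewrite powR_mulrn.
Qed.

(** The path argument on the product of the two given probability spaces. *)
Lemma third_moment_bound (R : realType)
  (d : measure_display) (T : measurableType d) (P : probability T R)
  (n : nat) (X : 'I_n.+1 -> {RV P >-> R})
  (X_indep : mutual_independence X)
  (X_id : identically_distributed X)
  (X_mean : ('E_P[X ord0] = 0)%E)
  (X_second : ('E_P[fun w => (X ord0 w ^+ 2)%R] = 1)%E)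
  (k : nat) (theta : 'I_k -> 'rV[R]_n.+1)
  (theta_orthonormal : forall i j, dotr (theta i) (theta j) = (i == j)%:R)
  (d' : measure_display) (T' : measurableType d') (Q : probability T' R)
  (Z : 'I_k -> {RV Q >-> R})
  (Z_normal : standard_normal_vector Z)
  (g : 'rV[R]_k -> R) (g_C2c : C2c g) :
  (`| 'E_P[fun w => g (\row_i dotr (theta i) (\row_r X r w))] -
      'E_Q[fun w => g (\row_i Z i w)] |
   <= (4 / 3 * k%:R ^+ 2)%R%:E * sup_hess g
        * 'E_P[fun w => (`|X ord0 w| ^+ 3)%R]
        * (\sum_(i < k) pnorm 3 (theta i) ^+ 3)%R%:E)%E.
Proof.
have [H HE ddgH] := sup_hess_fin g_C2c.
have H0 : 0 <= H by rewrite -lee_fin -HE sup_hess_ge0.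
have [B [gB dgB _]] := C2c_bounded g_C2c.
have C2g : C2 g := g_C2c.1.
have cg : continuous g := C2g.1.1.
pose Xf r w := X r w : R; pose Zf i w := Z i w : R.
pose th (i : 'I_k) (r : 'I_n.+1) := theta i 0 r.
have mX r : measurable_fun [set: T] (Xf r) by exact: measurable_funPT.
have mZ i : measurable_fun [set: T'] (Zf i) by exact: measurable_funPT.
pose PQ : probability (T * T')%type R := product_probability P Q.
pose W := juxtapose Xf Zf.
have mW s : measurable_fun [set: T * T'] (W s).
  by case: s => [r|i]; apply: measurableT_comp.
have iW : independent PQ W.
  apply: independent_juxtapose => //; first exact: mutual_independence_independent.
  exact: mutual_independence_independent Z_normal.1.
have nW i : standard_normal_law PQ (W (inr i)).
  move=> A mA; rewrite -(Z_normal.2 i A mA).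
  apply: (product_probability_snd P Q (A := Zf i @^-1` A)).
  by rewrite -[X in measurable X]setTI; exact: mZ.
have law r A : measurable A -> PQ (W (inl r) @^-1` A) = P (Xf ord0 @^-1` A).
  move=> mA; rewrite -[RHS](X_id r ord0 A mA).
  apply: (product_probability_fst P Q (A := Xf r @^-1` A)).
  by rewrite -[X in measurable X]setTI; exact: mX.
have second : (\int[P]_w (Xf ord0 w ^+ 2)%:E = 1)%E by move: X_second; rewrite unlock.
have mean : (\int[P]_w (Xf ord0 w)%:E = 0)%E by move: X_mean; rewrite unlock.
have jsq : P.-integrable [set: T] (EFin \o (fun w => Xf ord0 w ^+ 2)).
  apply/integrableP; split; first by apply/measurable_EFinP; exact: measurable_funX.
  under eq_integral do rewrite /= ger0_norm ?sqr_ge0//.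
  by rewrite second ltry.
have jid : P.-integrable [set: T] (EFin \o Xf ord0).
  apply: (@integrable_norm_le _ _ _ P _ (fun w => 1 + Xf ord0 w ^+ 2)) => //.
    have := integrableD measurableT (finite_measure_integrable_cst P 1 measurableT) jsq.
    by [].
  move=> w; set x := Xf ord0 w.
  have x2 : x ^+ 2 = `|x| ^+ 2 by rewrite real_normK// num_real.
  rewrite x2; have := sqr_ge0 (`|x| - 1); have : 0 <= `|x| by [].
  by move: `|x| => y; nra.
pose m3 := (\int[P]_w (`|Xf ord0 w| ^+ 3)%:E)%E.
have m30 : (0 <= m3)%E by apply: integral_ge0 => w _; rewrite lee_fin exprn_ge0.
have mrow : measurable_fun [set: T] (fun w => g (\row_j \sum_r th j r * Xf r w)).
  apply: (@measurable_continuous_row _ _ _ _ g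
    (fun j w => \sum_r th j r * Xf r w) cg) => j.
  by apply: measurable_sum => r; exact: measurable_funM.
have mrowZ : measurable_fun [set: T'] (fun w => g (\row_j Zf j w)).
  exact: measurable_continuous_row.
have jrow : P.-integrable [set: T]
    (EFin \o (fun w => g (\row_j \sum_r th j r * Xf r w))).
  exact: (@integrable_bounded _ _ _ P _ B mrow (fun w => gB _)).
have jrowZ : Q.-integrable [set: T'] (EFin \o (fun w => g (\row_j Zf j w))).
  exact: (@integrable_bounded _ _ _ Q _ B mrowZ (fun w => gB _)).
have ES : ('E_P[fun w => g (\row_i dotr (theta i) (\row_r X r w))] =
    (\int[PQ]_z g (\row_j \sum_r th j r * W (inl r) z))%:E)%E.
  rewrite (@equal_law_Rintegral _ _ _ _ _ _ _ PQ P fst id _ _ _ _ mrow)//.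
  - rewrite EFin_Rintegral// unlock; apply: eq_integral => w _; congr (g _)%:E.
    by apply/rowP => j; rewrite !mxE; apply: eq_bigr => r _; rewrite mxE.
  - by move=> A mA; exact: product_probability_fst.
have EZ : ('E_Q[fun w => g (\row_i Z i w)] =
    (\int[PQ]_z g (\row_j W (inr j) z))%:E)%E.
  rewrite (@equal_law_Rintegral _ _ _ _ _ _ _ PQ Q snd id _ _ _ _ mrowZ)//.
  - by rewrite EFin_Rintegral// unlock.
  - by move=> A mA; exact: product_probability_snd.
have jX r : PQ.-integrable [set: T * T'] (EFin \o W (inl r)).
  exact: (@equal_law_integrable _ _ _ _ _ _ _ PQ P _ _ (mW (inl r)) (mX ord0)
    (law r) id).
have X0 r : \int[PQ]_z W (inl r) z = 0.
  rewrite (@equal_law_Rintegral _ _ _ _ _ _ _ PQ P _ _ (mW (inl r)) (mX ord0)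
    (law r) id)//.
  by rewrite /Rintegral mean.
have msq : measurable_fun [set: R] (fun x : R => x ^+ 2) by exact: measurable_funX.
have jX2 r : PQ.-integrable [set: T * T'] (EFin \o (fun z => W (inl r) z ^+ 2)).
  exact: (@equal_law_integrable _ _ _ _ _ _ _ PQ P _ _ (mW (inl r)) (mX ord0)
    (law r) _ msq).
have X1 r : \int[PQ]_z (W (inl r) z ^+ 2) = 1.
  rewrite (@equal_law_Rintegral _ _ _ _ _ _ _ PQ P _ _ (mW (inl r)) (mX ord0)
    (law r) _ msq)//.
  by rewrite /Rintegral second.
have mcube : measurable_fun [set: R] (fun x : R => `|x| ^+ 3).
  by apply: measurable_funX; exact: normr_measurable.
have X3 r : (\int[PQ]_z (`|W (inl r) z| ^+ 3)%:E = m3)%E.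
  apply: (@equal_law_ge0 _ _ _ _ _ _ _ PQ P _ _ (mW (inl r)) (mX ord0)
    (law r) _ mcube).
  by move=> x; rewrite exprn_ge0.
have := smart_path_bound theta_orthonormal mW iW nW jX X0 jX2 X1 X3 m30
  C2g gB dgB ddgH H0.
rewrite ES EZ -EFinB abse_EFin => /le_trans; apply.
have -> : 'E_P[fun w => (`|X ord0 w| ^+ 3)%R]%E = m3 by rewrite unlock.
rewrite HE muleA -EFinM -EFinM muleAC -EFinM.
apply: lee_wpmul2r => //; rewrite lee_fin.
set e1 := 2 / _.
pose s r := \sum_i `|th i r|.
have -> : pi / 4 * (3 / 2 * e1 * H * \sum_r s r ^+ 3) =
    pi / 4 * (3 / 2 * e1) * (H * \sum_r s r ^+ 3) by ring.
have sum0 : 0 <= H * \sum_r s r ^+ 3.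
  by apply: mulr_ge0 => //; apply: sumr_ge0 => r _; rewrite exprn_ge0// sumr_ge0.
apply: (le_trans (ler_wpM2r sum0 smart_path_constant)).
have -> : 4 / 3 * k%:R ^+ 2 * H * \sum_(i < k) pnorm 3 (theta i) ^+ 3 =
    4 / 3 * (H * (k%:R ^+ 2 * \sum_(i < k) pnorm 3 (theta i) ^+ 3)) by ring.
rewrite ler_wpM2l// ler_wpM2l//.
have -> : \sum_(i < k) pnorm 3 (theta i) ^+ 3 = \sum_r \sum_(i < k) `|th i r| ^+ 3.
  by rewrite exchange_big; apply: eq_bigr => i _; rewrite pnorm3_cube.
rewrite mulr_sumr; apply: ler_sum => r _.
exact: cube_sum_le.
Qed.

Theorem theorem1 (R : realType)
  (d : measure_display) (T : measurableType d) (P : probability T R)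
  (n : nat) (X : 'I_n.+1 -> {RV P >-> R})
  (X_indep : mutual_independence X)
  (X_id : identically_distributed X)
  (X_mean : ('E_P[X ord0] = 0)%E)
  (X_second : ('E_P[fun w => (X ord0 w ^+ 2)%R] = 1)%E)
  (k : nat) (theta : 'I_k -> 'rV[R]_n.+1)
  (theta_orthonormal : forall i j, dotr (theta i) (theta j) = (i == j)%:R)
  (Sn : T -> 'rV[R]_k)
  (Sn_def : forall w,
     Sn w = \row_(i < k) dotr (theta i) (\row_(r < n.+1) X r w))
  (d' : measure_display) (T' : measurableType d') (Q : probability T' R)
  (Z : 'I_k -> {RV Q >-> R})
  (Z_normal : standard_normal_vector Z)
  (g : 'rV[R]_k -> R) (g_C2c : C2c g) :
  (`| 'E_P[fun w => g (Sn w)] - 'E_Q[fun w => g (\row_(i < k) Z i w)] |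
   <= (Num.sqrt k%:R / 2)%R%:E * sup_grad g
        * sqrte ('E_P[fun w => (X ord0 w ^+ 4)%R] - 1)
        * (\sum_(i < k) pnorm 4 (theta i) ^+ 2)%R%:E
      + (4 / 3 * k%:R ^+ 2)%R%:E * sup_hess g
        * 'E_P[fun w => (`|X ord0 w| ^+ 3)%R]
        * (\sum_(i < k) pnorm 3 (theta i) ^+ 3)%R%:E)%E.
Proof.
have -> : Sn = fun w => \row_(i < k) dotr (theta i) (\row_(r < n.+1) X r w).
  exact/funext.
apply: (le_trans (third_moment_bound X_indep X_id X_mean X_second
  theta_orthonormal Z_normal g_C2c)).
apply: leeDr; apply: mule_ge0; last first.
  by rewrite lee_fin; apply: sumr_ge0 => i _; exact: sqr_ge0.
apply: mule_ge0; last exact: sqrte_ge0.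
by apply: mule_ge0; [rewrite lee_fin divr_ge0|exact: sup_grad_ge0].
Qed.
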